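(* Let $R$ be the endomorphism ring of an elliptic curve, let $H$ be a finite subgroup of $GL(2,R)$ with $$H\cap SL(2,R)=\langle g\rangle\simeq C_3,$$ and let $h_o\in H$ be an element of order $r$ with $\det(H)=\langle\det(h_o)\rangle\simeq C_s$, $s>1$, and eigenvalues $\lambda_1(h_o),\lambda_2(h_o)$. Then $H$ is isomorphic to some $H_{C3}(i)$, $1\leq i\leq5$, where $H_{C3}(1)=\langle h_o\rangle\simeq C_6$ with $R=R_{-3,f}$, $\lambda_1(h_o)=e^{\frac{\pi i}{3}}$, $\lambda_2(h_o)=e^{\frac{2\pi i}{3}}$; $H_{C3}(2)=\langle g,h_o\mid g^3=h_o^2=I_2,\ h_ogh_o^{-1}=g^{-1}\rangle\simeq S_3$ is the symmetric group of degree $3$, $\lambda_1(h_o)=-1$, $\lambda_2(h_o)=1$; $H_{C3}(3)=\langle g\rangle\times\langle e^{\frac{2\pi i}{3}}I_2\rangle\simeq C_3\times C_3$ with $R=\mathcal{O}_{-3}$ and any $g\in SL(2,\mathcal{O}_{-3})$ of trace $\mathrm{tr}(g)=-1$; $H_{C3}(4)=\langle g\rangle\times\langle h_o\rangle\simeq C_3\times C_6$ with $R=\mathcal{O}_{-3}$, $\lambda_1(h_o)=e^{\frac{\pi i}{3}}$, $\lambda_2(h_o)=e^{-\frac{2\pi i}{3}}$; $H_{C3}(5)=\langle g,h_o\mid g^3=h_o^6=I_2,\ h_ogh_o^{-1}=g^{-1}\rangle$ of order $18$ with $R=\mathcal{O}_{-3}$, $\lambda_1(h_o)=e^{\frac{2\pi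 i}{3}}$, $\lambda_2(h_o)=e^{-\frac{\pi i}{3}}$. There exist subgroups $H_{C3}(1),H_{C3}(3),H_{C3}(4)<GL(2,\mathcal{O}_{-3})$, as well as subgroups $H^o_{C3}(2)<GL(2,\mathbb{Q}(\sqrt{-d}))$ and $H^o_{C3}(5)<GL(2,\mathbb{Q}(\sqrt{-3}))$ with $H^o_{C3}(j)\simeq H_{C3}(j)$ for $j\in\{2,5\}$.
   Context: $R=\mathrm{End}(E)$ for a complex elliptic curve $E$; thus $R=\mathbb{Z}$ or $R=R_{-d,f}=\mathbb{Z}+f\mathcal{O}_{-d}\subset\mathbb{C}$ with a conductor $f\in\mathbb{N}$ and $\mathcal{O}_{-d}$ the integers ring of an imaginary quadratic field $\mathbb{Q}(\sqrt{-d})$; in all cases $R\subset\mathbb{Q}(\sqrt{-d})$ (for $R=\mathbb{Z}$, with any $d\in\mathbb{N}$). $GL(2,R)=\{g\in R_{2\times2}:\det(g)\in R^*\}$, $SL(2,R)$ is its subgroup of matrices of determinant $1$, and $C_n$ is the cyclic group of order $n$. In the list, $g$ denotes an element of order $3$ of $SL(2,R)$ (equivalently, of trace $-1$) and $h_o$ an element of $GL(2,R)$ of the indicated order and with the indicated eigenvalues; ''with $R=\dots$'' means that the case is listed only for that ring. *)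

(* Defs.v *)
(* The field of complex numbers is R[i] for an arbitrary R : realType.
   Groups of matrices, and subgroups of the multiplicative group of C, are
   classical sets of units of the rings 'M[R[i]]_2 and R[i]. *)
From HB Require Import structures.
From mathcomp Require Import all_boot all_order all_algebra all_fingroup.
From mathcomp Require Import complex.
From mathcomp Require Import boolp classical_sets functions cardinality reals.
From mathcomp Require Import trigo.

Set Implicit Arguments.
Unset Strict Implicit.
Unset Printing Implicit Defensive.

Import Order.TTheory GRing.Theory Num.Theory.
Local Open Scope card_scope.
Local Open Scope classical_set_scope.
Local Open Scope ring_scope.

Section Groups.
Variable U : unitRingType.
Implicit Types (H K A B G : set U) (x : U).

Definition is_group H :=
  [/\ H `<=` [set x | x \is a GRing.unit],
      H 1,
      forall x y, H x -> H y -> H (x * y) &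
      forall x, H x -> H x^-1].

Definition is_subgroup H G := is_group H /\ H `<=` G.

(* The subgroup generated by A; only used for sets A of units (for other sets
   it would be the whole of U). *)
Definition gen_grp A : set U := smallest is_group A.

Definition has_order x (n : nat) :=
  [/\ (0 < n)%N, x ^+ n = 1 & forall m, (0 < m)%N -> x ^+ m = 1 -> (n <= m)%N].

Definition isom_grp H K :=
  exists f : U -> U,
    set_bij H K f /\ (forall x y, H x -> H y -> f (x * y) = f x * f y).

Definition isom_fin H (gT : finGroupType) (G : {group gT}) :=
  exists f : gT -> U,
    set_bij [set` G] H f /\ {in G &, forall a b, f (a * b)%g = f a * f b}.

(* K is the internal direct product of A and B. *)
Definition direct_product A B K :=
  [/\ K = [set x * y | x in A & y in B],
      A `&` B = [set 1] &
      forall x y, A x -> B y -> x * y = y * x].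

(* K = < g, h | g^3 = h^n = 1, h g h^-1 = g^-1 >: g and h generate K, satisfy
   the relations, and every pair satisfying them in a group X is the image of
   (g, h) under a homomorphism K -> X. *)
Definition presented n (g h : U) K :=
  [/\ K = gen_grp [set g; h],
      [/\ g ^+ 3 = 1, h ^+ n = 1 & h * g * h^-1 = g^-1] &
      forall (X : groupType) (x y : X),
        (x ^+ 3 = 1 -> y ^+ n = 1 -> y * x * y^-1 = x^-1 ->
         exists phi : U -> X,
           [/\ forall a b, K a -> K b -> phi (a * b)%R = phi a * phi b,
               phi g = x & phi h = y])%g].

End Groups.

Definition Cyc n : {group 'Z_n} := [group of Zp n].

Section Rings.
Variable R : realType.
Implicit Types (A : set R[i]) (z : R[i]).

Definition lattice (w1 w2 : R[i]) : set R[i] :=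
  [set z | exists m n : int, z = m%:~R * w1 + n%:~R * w2].

(* A is the endomorphism ring of the complex elliptic curve C / L, L a lattice
   of rank 2, each endomorphism being identified with the complex number by
   which it acts on the universal cover C. *)
Definition is_End_elliptic A :=
  exists w1 w2 : R[i],
    (forall a b : R, a%:C%C * w1 + b%:C%C * w2 = 0 -> a = 0 /\ b = 0) /\
    A = [set z | forall w, lattice w1 w2 w -> lattice w1 w2 (z * w)].

(* Q(sqrt(-d)) *)
Definition Qsqrt (d : nat) : set R[i] :=
  [set z | exists a b : rat, z = ratr a + ratr b * sqrtC (- d%:R)].

Definition ring_of_integers (d : nat) : set R[i] :=
  [set z | Qsqrt d z /\ integralOver (intr : int -> R[i]) z].

Definition quad_order (d f : nat) : set R[i] :=
  [set z | exists (m : int) (w : R[i]),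
     ring_of_integers d w /\ z = m%:~R + f%:R * w].

Definition ring_units A : set R[i] :=
  [set u | A u /\ exists v, A v /\ u * v = 1].

Definition expi (t : R) : R[i] := (cos t +i* sin t)%C.

End Rings.

Section GL2.
Variable R : realType.
Implicit Types (A : set R[i]) (g h : 'M[R[i]]_2) (K : set 'M[R[i]]_2).

Definition GL2 A : set 'M[R[i]]_2 :=
  [set g : 'M[R[i]]_2 | (forall i j, A (g i j)) /\ ring_units A (\det g)].

Definition SL2 A : set 'M[R[i]]_2 := [set g : 'M[R[i]]_2 | GL2 A g /\ \det g = 1].

(* l1, l2 are the eigenvalues of h, counted with algebraic multiplicity. *)
Definition eigenvalues h (l1 l2 : R[i]) :=
  char_poly h = ('X - l1%:P) * ('X - l2%:P).

(* HC3_i A K: K < GL(2, A) is a group of the kind H_C3(i). *)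

Definition HC3_1 A K :=
  (exists f, (0 < f)%N /\ A = quad_order 3 f) /\
  exists h,
    [/\ GL2 A h, has_order h 6, K = gen_grp [set h], isom_fin K (Cyc 6) &
        eigenvalues h (expi (pi / 3)) (expi (2 * pi / 3))].

Definition HC3_2 A K :=
  exists g h,
    [/\ SL2 A g /\ has_order g 3, GL2 A h /\ has_order h 2,
        presented 2 g h K, isom_fin K [group of [set: 'S_3]] &
        eigenvalues h (-1) 1].

(* The group <g> x <e^(2 pi i / 3) I_2> of the third case, for a given g. *)
Definition HC3_3_of A g K :=
  [/\ A = ring_of_integers 3, SL2 A g, \tr g = -1,
      direct_product (gen_grp [set g]) (gen_grp [set (expi (2 * pi / 3))%:M]) K &
      isom_fin K [group of finset.setX (Cyc 3) (Cyc 3)]].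

Definition HC3_3 A K := exists g, HC3_3_of A g K.

Definition HC3_4 A K :=
  A = ring_of_integers 3 /\
  exists g h,
    [/\ SL2 A g /\ has_order g 3, GL2 A h /\ has_order h 6,
        direct_product (gen_grp [set g]) (gen_grp [set h]) K,
        isom_fin K [group of finset.setX (Cyc 3) (Cyc 6)] &
        eigenvalues h (expi (pi / 3)) (expi (- (2 * pi / 3)))].

Definition HC3_5 A K :=
  A = ring_of_integers 3 /\
  exists g h,
    [/\ SL2 A g /\ has_order g 3, GL2 A h /\ has_order h 6,
        presented 6 g h K, K #= `I_18 &
        eigenvalues h (expi (2 * pi / 3)) (expi (- (pi / 3)))].

End GL2.

(* Main.v *)
Require Import Defs.
From mathcomp Require Import all_boot all_order all_algebra all_fingroup cyclic.
From mathcomp Require Import complex ring lra zify.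
From mathcomp Require Import boolp classical_sets functions cardinality reals.
From mathcomp Require Import trigo.

Set Implicit Arguments.
Unset Strict Implicit.
Unset Printing Implicit Defensive.

Import Order.TTheory GRing.Theory Num.Theory.
Local Open Scope card_scope.
Local Open Scope classical_set_scope.
Local Open Scope ring_scope.

(** Write zeta for a primitive sixth root of unity; then zeta^2 and zeta^4 are the
    primitive cube roots of unity and sqrt(-3) = 2 zeta - 1. In the classification
    the group K can be taken to be H itself.

    Arithmetic of A. Multiplication by z in A has an integral matrix on the
    lattice, so the trace z + conj z and the norm z conj z are integers
    ([End_traces]). A root of unity in A therefore has square -1 or is a power of
    zeta ([unit_trace]). If sqrt(-3) is in A then the integrality of the traces of
    z and z sqrt(-3) forces A to be contained in Z[zeta]
    ([eisenstein_of_traces]), so A is Z[zeta] or Z[2 zeta], the orders of conductor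
    1 and 2 ([order_sqrt3]), and it is Z[zeta] as soon as it contains zeta
    ([order_zeta]).

    Structure of H. The generator g has trace -1 and is diagonalizable with
    eigenvalues zeta^2 and zeta^4 ([trace_spec]). If k in H has a determinant that
    generates det H, then every element of H is a word g^a k^b ([H_words]). Since h
    normalizes <g>, either h g = g^2 h or h g = g h ([conj_cases]). The matrix -1
    is not in H, because it has determinant 1 and is not in <g>; this rules out
    most values of det h.

    - If h g = g^2 h, then tr h = 0 and h^2 = - det h. As -1 is not a power of h,
      det h is -1, which gives S_3, or a primitive sixth root of unity, which gives
      the group of order 18 ([inverting_case]).
    - If h g = g h, then h is diagonal in the eigenbasis of g. When det h = -1, the
      involution h^3 has eigenvalues 1 and -1, and tr (g h^3) is sqrt(-3) up to
      sign; so A contains sqrt(-3) and H is cyclic of order 6. The case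
      (det h)^2 = -1 would likewise put sqrt(-3) in A, and is impossible. Otherwise
      zeta is in A, the eigenvalues of h are sixth roots of unity
      ([eigenvalues_exp6]), a power of g times a power of h is the scalar zeta^2 or
      zeta^4 ([scalar_in_H]), and H is a direct product of <g> with the scalars of
      order 3, or with the group generated by the product of a scalar of order 3
      and an involution ([commuting_case]).

    All isomorphisms and presentations come from one principle: if the words
    x^a y^b are distinct for a mod m and b mod n, then sending each of them to the
    word with the same exponents in another pair satisfying the same relations is
    a well defined homomorphism ([word_transfer]). The groups of the existence
    part are generated by diagonal matrices, or by the companion matrix of
    X^2 + X + 1 together with a scalar or an antidiagonal matrix. *)

(** * Words x^a y^b *)

(** Stated for an arbitrary operation, so that the unit group of a ring, a finite
    group and an abstract group share the same computation rules. *)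
Definition word (T : Type) (one : T) (op : T -> T -> T) (x y : T) (a b : nat) :=
  op (iterop a op x one) (iterop b op y one).

Definition faithful (T : Type) (m n : nat) (w : nat -> nat -> T) :=
  forall a b c d, w a b = w c d -> a = c %[mod m] /\ b = d %[mod n].

Section Words.
Variables (T : Type) (one : T) (op : T -> T -> T).
Hypotheses (opA : associative op) (op1x : left_id one op) (opx1 : right_id one op).
Variables (x y : T) (m n e : nat).
Hypotheses (yx : op y x = op (iterop e op x one) y).
Hypotheses (xm : iterop m op x one = one) (yn : iterop n op y one = one).

Local Notation pw z k := (iterop k op z one).
Local Notation w := (word one op x y).

Lemma powS z k : pw z k.+1 = op z (pw z k).
Proof. by case: k => [|k] //=; rewrite opx1. Qed.

Lemma powD z j k : pw z (j + k) = op (pw z j) (pw z k).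
Proof.
elim: j => [|j IH]; first by rewrite add0n [RHS]op1x.
by rewrite addSn !powS IH opA.
Qed.

Lemma pow_comm k c : op (pw y k) (pw x c) = op (pw x (e ^ k * c)) (pw y k).
Proof.
have step j : op y (pw x j) = op (pw x (e * j)) y.
  elim: j => [|j IH]; first by rewrite muln0 /= opx1 op1x.
  by rewrite powS opA yx -opA IH opA -powD mulnS.
elim: k => [|k IH]; first by rewrite expn0 mul1n /= opx1 op1x.
by rewrite powS -opA IH opA step -opA mulnA -expnS.
Qed.

Lemma wordM a b c d : op (w a b) (w c d) = w (a + e ^ b * c) (b + d).
Proof.
rewrite /word !powD -!opA; congr (op _ _).
by rewrite !opA pow_comm.
Qed.

Lemma pow_mod z j k : pw z j = one -> pw z k = pw z (k %% j)%N.
Proof.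
move=> zj; rewrite {1}(divn_eq k j) powD.
suff -> : pw z (k %/ j * j)%N = one by rewrite op1x.
by elim: (k %/ j)%N => // q IH; rewrite mulSn powD zj IH opx1.
Qed.

Lemma word_mod a b : w a b = w (a %% m)%N (b %% n)%N.
Proof. by rewrite /word -!pow_mod. Qed.

Lemma word_eq a b c d : a = c %[mod m] -> b = d %[mod n] -> w a b = w c d.
Proof. by move=> ac bd; rewrite word_mod ac bd -word_mod. Qed.

End Words.

(** Words with faithful exponents determine these exponents up to the relations
    x^m = y^n = 1, so any other pair satisfying the same relations is a target:
    this is how both the universal property of a presentation and the
    isomorphisms with concrete finite groups are obtained. *)
Lemma word_transfer (T1 T2 : Type) (m n : nat) (w1 : nat -> nat -> T1)
    (w2 : nat -> nat -> T2) :
  faithful m n w1 ->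
  (forall a b c d, a = c %[mod m] -> b = d %[mod n] -> w2 a b = w2 c d) ->
  exists f : T1 -> T2, forall a b, f (w1 a b) = w2 a b.
Proof.
move=> fw1 w2E.
exists (fun t => if pselect (exists p, w1 p.1 p.2 = t) is left ex
                 then w2 (projT1 (cid ex)).1 (projT1 (cid ex)).2 else w2 0 0).
move=> a b; case: pselect => [ex|[]]; last by exists (a, b).
by case: (cid ex) => p /= /fw1[]; apply: w2E.
Qed.

(** The m n words of a faithful family are distinct, so they exhaust a group of
    order m n. *)
Lemma faithful_onto (gT : finType) (m n : nat) (w : nat -> nat -> gT)
    (G : {pred gT}) :
  faithful m n w -> (0 < m)%N -> (0 < n)%N -> #|G| = (m * n)%N ->
  (forall a b, w a b \in G) -> forall t, t \in G -> exists a b, t = w a b.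
Proof.
move=> fw m0 n0 cG wG t tG; pose f (p : 'I_m * 'I_n) := w p.1 p.2.
have finj : injective f.
  move=> [a b] [c d] /fw /= []; rewrite !modn_small // => ac bd.
  by congr pair; apply: val_inj.
have cf : #|codom f| = #|G| by rewrite card_codom // card_prod !card_ord.
have /(subset_cardP cf)/(_ t) : codom f \subset G.
  by apply/fintype.subsetP => _ /codomP[p ->]; apply: wG.
by rewrite tG => /codomP[p ->]; exists p.1, p.2.
Qed.

Definition words (U : unitRingType) (g h : U) : set U :=
  [set z | exists a b, z = g ^+ a * h ^+ b].

Section RingWords.
Variable U : unitRingType.
Implicit Types (g h : U) (H : set U).

Lemma words_isom (gT : finGroupType) (G : {group gT}) (x y : gT) g h m n e :
  (0 < m)%N -> (0 < n)%N -> #|G| = (m * n)%N ->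
  x \in G -> y \in G -> (x ^+ m = 1)%g -> (y ^+ n = 1)%g ->
  (y * x = x ^+ e * y)%g ->
  g ^+ m = 1 -> h ^+ n = 1 -> h * g = g ^+ e * h ->
  faithful m n (fun a b => x ^+ a * y ^+ b)%g ->
  faithful m n (fun a b => g ^+ a * h ^+ b) ->
  isom_fin (words g h) G.
Proof.
move=> m0 n0 cG xG yG xm yn yx gm hn hg fx fg.
have wx := wordM (@mulgA gT) (@mul1g gT) (@mulg1 gT) yx.
have wg := wordM (@mulrA U) (@mul1r U) (@mulr1 U) hg.
have ex := word_eq (@mulgA gT) (@mul1g gT) (@mulg1 gT) xm yn.
have eg := word_eq (@mulrA U) (@mul1r U) (@mulr1 U) gm hn.
have onto := faithful_onto fx m0 n0 cG
  (fun a b => groupM (groupX a xG) (groupX b yG)).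
have [f fE] := word_transfer fx eg.
exists f; split; last first.
  move=> s t /onto[a [b ->]] /onto[c [d ->]].
  by rewrite !fE wg -fE; congr f; apply: wx.
split.
- by move=> s /onto[a [b ->]]; exists a, b; apply: fE.
- move=> s t /set_mem/onto[a [b ->]] /set_mem/onto[c [d ->]].
  by rewrite !fE => /fg[ac bd]; apply: ex.
- move=> _ [a [b ->]]; exists (x ^+ a * y ^+ b)%g; last exact: fE.
  by rewrite /= groupM ?groupX.
Qed.

(** The index i < m n stands for the exponents i / n and i mod n. *)
Lemma words_card g h m n :
  (0 < m)%N -> (0 < n)%N -> g ^+ m = 1 -> h ^+ n = 1 ->
  faithful m n (fun a b => g ^+ a * h ^+ b) -> words g h #= `I_(m * n).
Proof.
move=> m0 n0 gm hn fg.
pose f i := g ^+ (i %/ n)%N * h ^+ (i %% n)%N.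
suff -> : words g h = f @` `I_(m * n).
  apply: inj_card_eq => i j /set_mem /= im /set_mem /= jm /fg[].
  rewrite !modn_mod ![(_ %/ _ %% m)%N]modn_small ?ltn_divLR // => ij ij'.
  by rewrite (divn_eq i n) (divn_eq j n) ij ij'.
apply/seteqP; split=> [_ [a [b ->]]|_ [i _ <-]]; last first.
  by exists (i %/ n)%N, (i %% n)%N.
exists (a %% m * n + b %% n)%N => /=.
  apply: (@leq_trans ((a %% m).+1 * n)); last by rewrite leq_pmul2r ?ltn_pmod.
  by rewrite mulSn addnC ltn_add2r ltn_pmod.
rewrite /f divnMDl // divn_small ?ltn_pmod // addn0 modnMDl modn_mod.
by rewrite !expr_mod.
Qed.

End RingWords.

(** * Generated groups *)

Section Generated.
Variable U : unitRingType.
Implicit Types (g h x : U) (H G A : set U).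

Lemma unit_of_exp x n : (0 < n)%N -> x ^+ n = 1 -> x \is a GRing.unit.
Proof. by move=> n0 xn; rewrite -(unitrX_pos _ n0) xn unitr1. Qed.

Lemma invX_exp x n k : (0 < n)%N -> x ^+ n = 1 -> (x ^+ k)^-1 = x ^+ (n.-1 * k).
Proof.
move=> n0 xn; have xU := unitrX k (unit_of_exp n0 xn).
rewrite -[LHS]mul1r; apply: (canLR (mulrK xU)).
by rewrite -exprD -mulSnr prednK // exprM xn expr1n.
Qed.

Lemma group_exp H x k : is_group H -> H x -> H (x ^+ k).
Proof.
move=> [_ H1 HM _] Hx; elim: k => [|k IH]; first by rewrite expr0.
by rewrite exprS; apply: HM.
Qed.

Lemma units_group : is_group [set x : U | x \is a GRing.unit].
Proof.
split=> //=; first exact: unitr1.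
- by move=> x y xU yU; rewrite unitrMl.
- by move=> x xU; rewrite unitrV.
Qed.

Lemma gen_grp_group A :
  A `<=` [set x | x \is a GRing.unit] -> is_group (gen_grp A).
Proof.
move=> AU; split.
- by apply: smallest_sub => //; apply: units_group.
- by move=> G [] [].
- by move=> x y Gx Gy G GA; case: (GA) => -[_ _ HM _] _; apply: HM;
    [apply: Gx | apply: Gy].
- by move=> x Gx G GA; case: (GA) => -[_ _ _ HV] _; apply: HV; apply: Gx.
Qed.

Lemma gen_grp1 h n : (0 < n)%N -> h ^+ n = 1 ->
  gen_grp [set h] = [set z | exists b, z = h ^+ b].
Proof.
move=> n0 hn; have hU := unit_of_exp n0 hn.
apply/seteqP; split; last first.
  move=> _ [b ->]; suff G : is_group (gen_grp [set h]).
    by apply: (group_exp _ G); apply: sub_gen_smallest.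
  by apply: gen_grp_group => _ ->.
apply: smallest_sub; last by move=> _ ->; exists 1%N.
split.
- by move=> _ [b ->]; apply: unitrX.
- by exists 0%N.
- by move=> _ _ [a ->] [b ->]; exists (a + b)%N; rewrite exprD.
- by move=> _ [b ->]; exists (n.-1 * b)%N; apply: invX_exp.
Qed.

Section TwoGenerators.
Variables (g h : U) (m n e : nat).
Hypotheses (m0 : (0 < m)%N) (n0 : (0 < n)%N).
Hypotheses (gm : g ^+ m = 1) (hn : h ^+ n = 1) (hg : h * g = g ^+ e * h).

Lemma words_mul a b c d :
  (g ^+ a * h ^+ b) * (g ^+ c * h ^+ d) = g ^+ (a + e ^ b * c) * h ^+ (b + d).
Proof. exact: (wordM (@mulrA U) (@mul1r U) (@mulr1 U) hg). Qed.

Lemma words_group : is_group (words g h).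
Proof.
have gU := unit_of_exp m0 gm; have hU := unit_of_exp n0 hn.
split.
- by move=> _ [a [b ->]]; rewrite /= unitrMl ?unitrX.
- by exists 0%N, 0%N; rewrite mulr1.
- by move=> _ _ [a [b ->]] [c [d ->]]; rewrite words_mul; do 2!eexists.
- move=> _ [a [b ->]].
  suff -> : (g ^+ a * h ^+ b)^-1 =
            (g ^+ 0 * h ^+ (n.-1 * b)) * (g ^+ (m.-1 * a) * h ^+ 0).
    by rewrite words_mul; do 2!eexists.
  by rewrite mulr1 mul1r invrM ?unitrX // !(invX_exp _ _ gm, invX_exp _ _ hn).
Qed.

Lemma gen_grp2 : gen_grp [set g; h] = words g h.
Proof.
apply/seteqP; split.
  apply: smallest_sub => [|_ [] ->]; first exact: words_group.
    by exists 1%N, 0%N; rewrite mulr1.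
  by exists 0%N, 1%N; rewrite mul1r.
have G : is_group (gen_grp [set g; h]).
  by apply: gen_grp_group => _ [] -> /=;
    [exact: (unit_of_exp m0 gm)|exact: (unit_of_exp n0 hn)].
have [_ _ GM _] := G.
have [Gg Gh] : gen_grp [set g; h] g /\ gen_grp [set g; h] h.
  by split; apply: sub_gen_smallest; [left|right].
by move=> _ [a [b ->]]; apply: GM;
  [exact: (group_exp _ G Gg)|exact: (group_exp _ G Gh)].
Qed.

Hypothesis fgh : faithful m n (fun a b => g ^+ a * h ^+ b).

Lemma words_direct_product :
  h * g = g * h -> Defs.direct_product (gen_grp [set g]) (gen_grp [set h]) (words g h).
Proof.
move=> comm; rewrite (gen_grp1 m0 gm) (gen_grp1 n0 hn); split.
- apply/seteqP; split=> [_ [a [b ->]]|_ [_ [a ->] [_ [b ->] <-]]]; last first.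
    by exists a, b.
  by exists (g ^+ a); [exists a|exists (h ^+ b); [exists b|]].
- apply/seteqP; split=> [z [[a ->] [b E]]|_ ->]; last by split; exists 0%N.
  have [] := @fgh a 0%N 0%N b; first by rewrite mulr1 mul1r.
  by rewrite mod0n => am _; rewrite -(expr_mod _ gm) am.
- by move=> _ _ [a ->] [b ->]; apply/commrX/commr_sym/commrX.
Qed.

End TwoGenerators.

(** The universal property holds because the words g^a h^b are distinct for
    exponents modulo 3 and n, and multiply by a rule that only uses the relations. *)
Lemma words_presented g h n :
  (0 < n)%N -> g ^+ 3 = 1 -> h ^+ n = 1 -> h * g = g ^+ 2 * h ->
  faithful 3 n (fun a b => g ^+ a * h ^+ b) -> presented n g h (words g h).
Proof.
move=> n0 g3 hn hg fgh.
have gU := unit_of_exp (ltn0Sn 2) g3; have hU := unit_of_exp n0 hn.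
split; first by rewrite (gen_grp2 _ n0 g3 hn hg).
- split=> //; rewrite hg mulrK //.
  by rewrite -[RHS]mulr1 -g3 [g ^+ 3]exprS mulKr.
- move=> X x y x3 yn yx.
  have {}yx : (y * x = x ^+ 2 * y)%g.
    have -> : (x ^+ 2 = x^-1)%g by rewrite -[RHS]mulg1 -x3 [(x ^+ 3)%g]expgS mulKg.
    by rewrite -yx mulgKV.
  have [phi phiE] := word_transfer fgh
    (word_eq (@mulgA X) (@mul1g X) (@mulg1 X) x3 yn).
  exists phi; split.
  + move=> _ _ [a [b ->]] [c [d ->]].
    rewrite (words_mul hg) !phiE.
    by rewrite (wordM (@mulgA X) (@mul1g X) (@mulg1 X) yx).
  + by rewrite -[g]mulr1 -[g]expr1 -(expr0 h) phiE /word /= mulg1.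
  + by rewrite -[h]mul1r -[h]expr1 -(expr0 g) phiE /word /= mul1g.
Qed.

End Generated.

(** * The abstract groups of the list *)

Lemma mem_Cyc n (x : 'Z_n) : (1 < n)%N -> x \in Cyc n.
Proof. by move=> n1; rewrite /Cyc /= /Zp n1 inE. Qed.

Lemma Cyc_card n : (1 < n)%N -> #|Cyc n| = n.
Proof. by move=> n1; rewrite card_Zp // ltnW. Qed.

Lemma Zp1_order n : (1 < n)%N -> #[Zp1 : 'Z_n]%g = n.
Proof. by move=> n1; rewrite -{3}(Zp_cast n1) -(order_Zp1 (Zp_trunc n).+1). Qed.

Lemma Zp1_expn n : (1 < n)%N -> ((Zp1 : 'Z_n) ^+ n = 1)%g.
Proof. by move=> n1; have := expg_order (Zp1 : 'Z_n); rewrite Zp1_order. Qed.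

Lemma pair_expg (gT rT : finGroupType) (x : gT) (y : rT) k :
  (((x, y) : gT * rT) ^+ k = (x ^+ k, y ^+ k))%g.
Proof. by elim: k => // k IH; rewrite !expgS IH. Qed.

Section IsomConcrete.
Variable U : unitRingType.
Implicit Types (g h : U) (H : set U).

(** A cyclic group is treated as a group of words whose first letter is trivial. *)
Lemma words_Cyc h n : (1 < n)%N -> h ^+ n = 1 ->
  faithful 1 n (fun a b => 1 ^+ a * h ^+ b) -> isom_fin (words 1 h) (Cyc n).
Proof.
move=> n1 hn fh; have o := Zp1_order n1.
apply: (words_isom (x := 1%g) (y := Zp1 : 'Z_n) (m := 1) (n := n) (e := 1)) => //.
- exact: ltnW.
- by rewrite Cyc_card // mul1n.
- exact: mem_Cyc.
- exact: Zp1_expn.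
- by rewrite mulg1 mul1g.
- by rewrite mulr1 mul1r.
- move=> a b c d; rewrite !expg1n !mul1g !modn1 => /eqP.
  by rewrite eq_expg_mod_order o => /eqP.
Qed.

Lemma words_Cyc_prod g h m n : (1 < m)%N -> (1 < n)%N ->
  g ^+ m = 1 -> h ^+ n = 1 -> h * g = g * h ->
  faithful m n (fun a b => g ^+ a * h ^+ b) ->
  isom_fin (words g h) [group of finset.setX (Cyc m) (Cyc n)].
Proof.
move=> m1 n1 gm hn hg fgh; have om := Zp1_order m1; have on := Zp1_order n1.
apply: (words_isom (x := (Zp1 : 'Z_m, 1%g : 'Z_n)) (y := (1%g : 'Z_m, Zp1 : 'Z_n))
                   (m := m) (n := n) (e := 1)) => //.
- exact: ltnW.
- exact: ltnW.
- by rewrite /= cardsX !Cyc_card.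
- by rewrite inE !mem_Cyc.
- by rewrite inE !mem_Cyc.
- by rewrite pair_expg expg1n Zp1_expn.
- by rewrite pair_expg expg1n Zp1_expn.
- by congr pair; rewrite !(mulg1, mul1g).
- move=> a b c d; rewrite !pair_expg !expg1n => E.
  have E1 : (Zp1 ^+ a * 1 = Zp1 ^+ c * 1 :> 'Z_m)%g := congr1 fst E.
  have E2 : (1 * Zp1 ^+ b = 1 * Zp1 ^+ d :> 'Z_n)%g := congr1 snd E.
  move: E1 E2; rewrite !mulg1 !mul1g => /eqP E1 /eqP; move: E1.
  by rewrite !eq_expg_mod_order om on => /eqP ? /eqP.
Qed.

(** In S_3 the same relations hold for a 3-cycle and a transposition, and the sign
    separates the exponents of the transposition. *)
Lemma words_S3 g h : g ^+ 3 = 1 -> h ^+ 2 = 1 -> h * g = g ^+ 2 * h ->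
  faithful 3 2 (fun a b => g ^+ a * h ^+ b) ->
  isom_fin (words g h) [group of [set: 'S_3]].
Proof.
move=> g3 h2 hg fgh.
pose i0 : 'I_3 := inord 0; pose i1 : 'I_3 := inord 1; pose i2 : 'I_3 := inord 2.
have [n01 n12 n02] : [/\ i0 != i1, i1 != i2 & i0 != i2].
  by split; rewrite -val_eqE /= !inordK.
pose s := tperm i0 i1; pose t := tperm i1 i2.
have ss : (s * s = 1)%g by exact: tperm2.
have tt : (t * t = 1)%g by exact: tperm2.
have braid : (s * t * s = t * s * t)%g.
  have -> : (s * t * s = t ^ s)%g by rewrite conjgE tpermV mulgA.
  have -> : (t * s * t = s ^ t)%g by rewrite conjgE tpermV mulgA.
  by rewrite !tpermJ tpermR tpermL !tpermD // eq_sym.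
have x3 : ((s * t) ^+ 3 = 1)%g.
  rewrite !expgS expg0 mulg1.
  have -> : (s * t * (s * t * (s * t)) = (s * t * s) * (t * s * t))%g.
    by rewrite !mulgA.
  by rewrite braid !mulgA -(mulgA _ t t) tt mulg1 -(mulgA _ s s) ss mulg1 tt.
have st1 : (s * t != 1)%g.
  apply/eqP => /permP/(_ i0); rewrite permM tpermL perm1 tpermL => /eqP.
  by rewrite eq_sym (negPf n02).
have ox : #[s * t]%g = 3 by apply: nt_prime_order.
have odd_t : odd_perm t by rewrite odd_tperm.
have odd_x : odd_perm (s * t)%g = false by rewrite odd_permM !odd_tperm n01 n12.
apply: (words_isom (x := (s * t)%g) (y := t) (m := 3) (n := 2) (e := 2)) => //.
- by rewrite cardsT card_Sn.
- by rewrite inE.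
- by rewrite inE.
- by rewrite !expgS expg0 mulg1 !mulgA -braid -(mulgA _ t t) tt mulg1.
- have oddX (u : 'S_3) k : odd_perm (u ^+ k)%g = odd k && odd_perm u.
    elim: k => [|k IH]; first by rewrite expg0 odd_perm1.
    by rewrite expgS odd_permM IH /=; case: (odd_perm u); case: (odd k).
  have oddw a b : odd_perm ((s * t) ^+ a * t ^+ b)%g = odd b.
    by rewrite odd_permM !oddX odd_x odd_t andbF andbT.
  move=> a b c d E; have bd : b = d %[mod 2].
    by rewrite !modn2 -(oddw a) E oddw.
  split=> //; apply/eqP; have := eq_expg_mod_order (s * t)%g a c.
  rewrite ox => <-; apply/eqP.
  have tbd : (t ^+ b = t ^+ d)%g.
    by rewrite -(expg_mod (p := 2) b tt) bd expg_mod.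
  by move: E; rewrite tbd => /mulIg.
Qed.

End IsomConcrete.

(** * Arithmetic in the ring of Eisenstein integers *)

Definition subring (K : pzRingType) (A : set K) :=
  [/\ A 1, forall x y, A x -> A y -> A (x - y) &
      forall x y, A x -> A y -> A (x * y)].

Section Subring.
Variables (K : pzRingType) (A : set K).
Hypothesis A_ring : subring A.

Lemma subring0 : A 0.
Proof. by case: A_ring => A1 AB _; rewrite -(subrr 1); apply: AB. Qed.

Lemma subringN x : A x -> A (- x).
Proof.
by case: A_ring => A1 AB _ Ax; rewrite -(sub0r x); apply: AB (subring0) Ax.
Qed.

Lemma subringD x y : A x -> A y -> A (x + y).
Proof.
by case: A_ring => A1 AB _ Ax Ay; rewrite -(opprK y); apply/AB/subringN.
Qed.

Lemma subringX x k : A x -> A (x ^+ k).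
Proof.
case: A_ring => A1 _ AM Ax.
by elim: k => [|k IH]; rewrite ?expr0 // exprS; apply: AM.
Qed.

Lemma subring_int (m : int) : A m%:~R.
Proof.
have nat n : A n%:R.
  elim: n => [|n IH]; first exact: subring0.
  by rewrite -addn1 natrD; apply: subringD IH _; case: A_ring.
by case: m => n; rewrite ?NegzE ?intrN -pmulrn //; apply: subringN.
Qed.

End Subring.

Lemma three_dvd_sqr (q k : int) : q ^+ 2 = 3 * k -> exists b, q = 3 * b.
Proof.
move=> qk; exists (divz q 3).
move: (divz_eq q 3) (modz_ge0 q (isT : 3 != 0 :> int)).
have := ltz_pmod q (isT : 0 < 3 :> int).
move: (divz q 3) (modz q 3) => j r rlt qjr r0.
have sq : q ^+ 2 = 9 * (j * j) + 6 * (j * r) + r * r by rewrite qjr; ring.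
move: qk; rewrite sq; move: (j * j) => jj qk.
suff r_0 : r = 0 by lia.
have [r_0 | [r_1 | r_2]] : r = 0 \/ r = 1 \/ r = 2 by lia.
- by [].
- by exfalso; rewrite r_1 in qk; lia.
- by exfalso; rewrite r_2 in qk; lia.
Qed.

Section Eisenstein.
Variable R : realType.
Local Notation C := R[i].
Implicit Types (z u d : C) (A : set C).

(** The primitive sixth root of unity, root of X^2 - X + 1 and generator of the
    Eisenstein integers; locked, so that its powers are compared through its
    relations and not through its coordinates. *)
Definition zeta : C := locked (expi (pi / 3)).
(** The square root of -3 with positive imaginary part. *)
Definition sqrt3 : C := 2 * zeta - 1.
Definition integer : set C := [set z | exists m : int, z = m%:~R].
Definition reltrace z := z + z^*%C.
Definition relnorm z := z * z^*%C.

Lemma conjB z u : (z - u)^*%C = z^*%C - u^*%C.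
Proof. exact: rmorphB. Qed.

Lemma conjD z u : (z + u)^*%C = z^*%C + u^*%C.
Proof. exact: rmorphD. Qed.

Lemma conjM z u : (z * u)^*%C = z^*%C * u^*%C.
Proof. exact: rmorphM. Qed.

Lemma expiD (s t : R) : expi (s + t) = expi s * expi t.
Proof. by rewrite /expi cosD sinD; simpc; congr (_ +i* _)%C; rewrite addrC. Qed.

Lemma conj_expi (t : R) : (expi t)^*%C = expi (- t).
Proof. by rewrite /expi cosN sinN. Qed.

Lemma expi0 : expi 0 = 1 :> C.
Proof. by rewrite /expi cos0 sin0. Qed.

Lemma zetaE : zeta = expi (pi / 3).
Proof. by rewrite /zeta -lock. Qed.

Lemma zeta_conj : zeta * zeta^*%C = 1.
Proof. by rewrite zetaE conj_expi -expiD subrr expi0. Qed.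

(** From zeta^3 = -1 and zeta <> -1, zeta having a positive imaginary part. *)
Lemma zeta_sqr : zeta ^+ 2 = zeta - 1.
Proof.
have z3 : zeta ^+ 3 = -1.
  rewrite zetaE !exprS expr0 mulr1 -!expiD.
  have -> : pi / 3 + (pi / 3 + pi / 3) = pi :> R by field.
  by rewrite /expi cospi sinpi; apply/eqP; rewrite eq_complex /= oppr0 !eqxx.
have nz : zeta + 1 != 0.
  rewrite zetaE; apply/eqP => /(congr1 (@complex.Im R)) /= /eqP; rewrite addr0 gt_eqF //.
  by apply: sin_gt0_pi; have := pi_gt0 R; lra.
apply: (mulfI nz); rewrite -[RHS]subr0 -[LHS]subr0.
have -> : (zeta + 1) * zeta ^+ 2 = zeta ^+ 3 + zeta ^+ 2 by ring.
by rewrite z3; ring.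
Qed.

Lemma zeta3 : zeta ^+ 3 = -1.
Proof. by rewrite exprS zeta_sqr mulrBr -expr2 zeta_sqr; ring. Qed.

Lemma conj_zeta : zeta^*%C = 1 - zeta.
Proof.
have nz : zeta != 0.
  apply/eqP => z0; have := zeta_conj.
  by rewrite z0 mul0r => /eqP; rewrite eq_sym oner_eq0.
by apply: (mulfI nz); rewrite zeta_conj mulrBr -expr2 zeta_sqr; ring.
Qed.

Lemma zeta_prim : 6.-primitive_root zeta.
Proof.
have z6 : zeta ^+ 6 = 1 by rewrite (exprM _ 3 2) zeta3 expr2; ring.
have [k kp k6] := prim_order_exists (isT : (0 < 6)%N) z6.
have z3 := zeta3; have z2 := zeta_sqr.
have n2 : (2 : C) != 0 by rewrite pnatr_eq0.
have n3 : (3 : C) != 0 by rewrite pnatr_eq0.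
have k3 : ~~ (k %| 3)%N.
  rewrite (prim_order_dvd kp) z3; apply: contraNN n2 => /eqP e.
  have -> : (2 : C) = 1 - (-1) by ring.
  by rewrite e subrr.
have k2 : ~~ (k %| 2)%N.
  rewrite (prim_order_dvd kp) z2; apply: contraNN n3 => /eqP e.
  have ez : zeta = 2 by rewrite -[LHS](subrK 1) e; ring.
  have -> : (3 : C) = zeta ^+ 2 - (zeta - 1) by rewrite ez; ring.
  by rewrite z2 subrr.
have : k \in divisors 6 by rewrite -dvdn_divisors.
by rewrite !inE => /or4P[] /eqP ek; move: kp k2 k3; rewrite ek.
Qed.

Lemma sqrt3_sqr : sqrt3 ^+ 2 = -3.
Proof.
have -> : sqrt3 ^+ 2 = 4 * zeta ^+ 2 - 4 * zeta + 1 by rewrite /sqrt3; ring.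
by rewrite zeta_sqr; ring.
Qed.

Lemma conj_sqrt3 : sqrt3^*%C = - sqrt3.
Proof.
have -> : sqrt3 = zeta - zeta^*%C by rewrite conj_zeta /sqrt3; ring.
by rewrite conjB conjcK opprB.
Qed.

Lemma intC_inj (m n : int) : m%:~R = n%:~R :> C -> m = n.
Proof. exact: intr_inj. Qed.

(** The conjugates of z and of z sqrt(-3) determine z: with t = Tr z and
    q = Tr (z sqrt(-3)) one has q^2 + 3 t^2 = 12 N z, so that q = 3 b and t
    has the parity of b, whence z = (t - b sqrt(-3)) / 2 is in Z[zeta]. *)
Lemma eisenstein_of_traces z :
  integer (reltrace z) -> integer (reltrace (z * sqrt3)) -> integer (relnorm z) ->
  exists a b : int, z = a%:~R + b%:~R * zeta.
Proof.
move=> [t tE] [q qE] [N NE].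
have s2 := sqrt3_sqr.
have qz : sqrt3 * (z - z^*%C) = q%:~R.
  by rewrite -qE /reltrace conjM conj_sqrt3; ring.
have eqI : q ^+ 2 + 3 * t ^+ 2 = 12 * N.
  apply: intC_inj; rewrite !(rmorphD, rmorphM, rmorphXn) /= -qz -tE -NE.
  by rewrite /reltrace /relnorm exprMn s2; ring.
have [b qb] : exists b : int, q = 3 * b.
  by apply: (@three_dvd_sqr _ (4 * N - t ^+ 2)); lia.
have [a ta] : exists a : int, t = 2 * a - b.
  exists (divz (t + b) 2).
  move: (divz_eq (t + b) 2) (modz_ge0 (t + b) (isT : 2 != 0 :> int)).
  have := ltz_pmod (t + b) (isT : 0 < 2 :> int).
  move: (divz _ 2) (modz _ 2) => k r rlt tkr r0.
  have tE' : t = k * 2 + r - b by lia.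
  have sq : 12 * N = 12 * (b * b) - 12 * (k * b) - 6 * (r * b)
                     + 12 * (k * k) + 12 * (k * r) + 3 * (r * r).
    by rewrite -eqI qb tE'; ring.
  move: sq; move: (b * b) (k * b) (k * k) => bb kb kk sq.
  suff r_0 : r = 0 by lia.
  have [r_0 | r_1] : r = 0 \/ r = 1 by lia.
  - by [].
  - by exfalso; rewrite r_1 in sq; lia.
exists a, (- b).
have n2 : (2 : C) != 0 by rewrite pnatr_eq0.
have n3 : (3 : C) != 0 by rewrite pnatr_eq0.
apply: (mulfI n2); apply: (mulfI n3).
have -> : 3 * (2 * z) = 3 * reltrace z - sqrt3 * (sqrt3 * (z - z^*%C)).
  have -> : sqrt3 * (sqrt3 * (z - z^*%C)) = sqrt3 ^+ 2 * (z - z^*%C) by ring.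
  by rewrite s2 /reltrace; ring.
by rewrite qz tE qb ta !(intrD, intrM, intrN) /sqrt3; ring.
Qed.

End Eisenstein.

Section Orders.
Variable R : realType.
Local Notation C := R[i].
Local Notation zeta := (zeta R).
Local Notation sqrt3 := (sqrt3 R).
Local Notation integer := (@integer R).
Implicit Types (z u d : C) (A : set C).

Definition eisenstein : set C :=
  [set z | exists a b : int, z = a%:~R + b%:~R * zeta].

Definition integral_traces A :=
  forall z, A z -> integer (reltrace z) /\ integer (relnorm z).

Lemma root_of_trace z : z ^+ 2 = reltrace z * z - relnorm z.
Proof. by rewrite /reltrace /relnorm; ring. Qed.

(** As (u - conj u)^2 = m^2 - 4 is not positive, |m| <= 2; and u is a root of
    X^2 - m X + 1. *)
Lemma small_trace u (m : int) : relnorm u = 1 -> reltrace u = m%:~R -> m != 0 ->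
  u ^+ 6 = 1.
Proof.
move=> u1 um m0; have sq := root_of_trace u; rewrite u1 um in sq.
have m4 : (0 : int) <= 4 - m ^+ 2.
  rewrite -(ler0z C); have := mulcJ_ge0 (u - u^*%C).
  rewrite conjB conjcK; congr (_ <= _).
  rewrite intrB rmorphXn /= -um /reltrace.
  have -> : 4%:~R = 4 * relnorm u by rewrite u1 mulr1.
  by rewrite /relnorm; ring.
have n4 : ((-2 <= m) && (m <= 2)) by nia.
have n2 : (2 : C) != 0 by rewrite pnatr_eq0.
have [|[|[|]]] : m = 2 \/ m = -2 \/ m = 1 \/ m = -1 by lia.
- move=> e; rewrite e in sq.
  suff -> : u = 1 by rewrite expr1n.
  apply/eqP; rewrite -subr_eq0 -sqrf_eq0; apply/eqP.
  by rewrite sqrrB sq; ring.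
- move=> e; rewrite e in sq.
  suff -> : u = -1 by ring.
  apply/eqP; rewrite -subr_eq0 opprK -sqrf_eq0; apply/eqP.
  by rewrite sqrrD sq; ring.
- move=> e; rewrite e in sq.
  have -> : u ^+ 6 = (u * u ^+ 2) ^+ 2 by ring.
  have -> : u * u ^+ 2 = -1 by rewrite sq mul1r mulrBr -expr2 sq; ring.
  by ring.
- move=> e; rewrite e in sq.
  have -> : u ^+ 6 = (u * u ^+ 2) ^+ 2 by ring.
  have -> : u * u ^+ 2 = 1 by rewrite sq mulrBr mulN1r mulrN -expr2 sq; ring.
  by ring.
Qed.

Lemma unit_trace d : relnorm d = 1 -> integer (reltrace d) -> d ^+ 2 = -1 \/ d ^+ 6 = 1.
Proof.
move=> d1 [m dm]; have [m0|m0] := eqVneq m 0; last by right; apply: small_trace m0.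
by left; rewrite root_of_trace d1 dm m0 mul0r sub0r.
Qed.

(** If u sqrt(-3) has integral trace and so has -3 u then, with t the former and
    -3 m the latter, 12 = t^2 + 3 m^2; so m is an integer, not 0 because 12 is
    not a square. *)
Lemma sixth_root u : relnorm u = 1 ->
  integer (reltrace (u * sqrt3)) -> integer (reltrace (u * sqrt3 * sqrt3)) -> u ^+ 6 = 1.
Proof.
move=> u1 [t tE] [q qE]; have s2 := sqrt3_sqr R.
have uq : (-3) * reltrace u = q%:~R.
  rewrite -qE /reltrace !conjM conj_sqrt3.
  have -> : u * sqrt3 * sqrt3 = u * sqrt3 ^+ 2 by ring.
  have -> : u^*%C * - sqrt3 * - sqrt3 = u^*%C * sqrt3 ^+ 2 by ring.
  by rewrite s2; ring.
have ut : sqrt3 * (u - u^*%C) = t%:~R.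
  by rewrite -tE /reltrace conjM conj_sqrt3; ring.
have eqI : q ^+ 2 + 3 * t ^+ 2 = 36.
  apply: (@intC_inj R); rewrite !(rmorphD, rmorphM, rmorphXn) /= -uq -ut.
  transitivity (36 * relnorm u); last by rewrite u1 mulr1.
  by rewrite [(sqrt3 * _) ^+ 2]exprMn s2 /reltrace /relnorm; ring.
have [b qb] : exists b : int, q = 3 * b.
  by apply: (@three_dvd_sqr _ (12 - t ^+ 2)); lia.
have n3 : (-3 : C) != 0 by rewrite oppr_eq0 pnatr_eq0.
apply: (small_trace (m := - b)) u1 _ _.
  by apply: (mulfI n3); rewrite uq qb intrM intrN; ring.
rewrite oppr_eq0; apply/eqP => b0; move: eqI; rewrite qb b0.
by case: t {tE ut} => -[|[|[|[|[|t]]]]]; lia.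
Qed.

Lemma eisenstein_ring : subring eisenstein.
Proof.
split.
- by exists 1, 0; rewrite mul0r addr0.
- move=> _ _ [a [b ->]] [c [d ->]]; exists (a - c), (b - d).
  by rewrite !intrB; ring.
- move=> _ _ [a [b ->]] [c [d ->]]; exists (a * c - b * d), (a * d + b * c + b * d).
  rewrite !(intrB, intrD, intrM).
  transitivity (a%:~R * c%:~R + (a%:~R * d%:~R + b%:~R * c%:~R) * zeta
                + b%:~R * d%:~R * zeta ^+ 2); first by ring.
  by rewrite zeta_sqr; ring.
Qed.

Lemma zeta_eisenstein : eisenstein zeta.
Proof. by exists 0, 1; rewrite add0r mul1r. Qed.

Lemma sub_eisenstein A : subring A -> A sqrt3 -> integral_traces A ->
  A `<=` eisenstein.
Proof.
move=> [_ _ AM] As At z Az; have [zt zn] := At _ Az.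
by apply: eisenstein_of_traces => //; case: (At _ (AM _ _ Az As)).
Qed.

Lemma eisenstein_sub A : subring A -> A zeta -> eisenstein `<=` A.
Proof.
move=> Ar Az _ [a [b ->]]; apply: subringD => //; first exact: subring_int.
by case: (Ar) => _ _; apply => //; apply: subring_int.
Qed.

(** Gauss's lemma: X - r divides a monic integral polynomial, so it is proportional
    to an integral polynomial whose leading coefficient is 1 or -1. *)
Lemma rational_integral z (r : rat) :
  z = ratr r -> integralOver (intr : int -> C) z -> integer z.
Proof.
move=> zr [p pm rp].
have rQ : root (map_poly (intr : int -> rat) p) r.
  rewrite -(fmorph_root (ratr : rat -> C)) -map_poly_comp /= -zr.
  by rewrite (eq_map_poly (ratr_int C)).
rewrite root_factor_theorem in rQ.
have [p1 [a a0 e] [q pq]] := dvdpP_rat_int rQ.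
have lp : lead_coef p1 * lead_coef q = 1.
  by rewrite -lead_coefM -pq; apply/eqP.
have le : 1 = a * (lead_coef p1)%:~R.
  have := congr1 lead_coef e.
  rewrite lead_coefXsubC lead_coefZ lead_coef_map_inj //.
  by move=> x y /eqP; rewrite eqr_int => /eqP.
have ce : - r = a * (p1`_0)%:~R.
  have : ('X - r%:P)`_0 = (a *: map_poly intr p1)`_0 by rewrite -e.
  by rewrite coefB coefX coefC coefZ coef_map /= sub0r.
have l2 : lead_coef p1 = 1 \/ lead_coef p1 = -1.
  have /eqP := congr1 absz lp; rewrite abszM muln_eq1 => /andP[/eqP + _]; lia.
exists (- (lead_coef p1 * p1`_0)); rewrite zr -ratr_int; congr ratr.
apply: oppr_inj; rewrite ce intrN opprK intrM.
case: l2 le => ->; rewrite ?mulr1 ?mulrN1 => le; first by rewrite -le mul1r.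
by rewrite -[a]opprK -le.
Qed.

End Orders.

Section Rings.
Variable R : realType.
Local Notation C := R[i].
Local Notation zeta := (zeta R).
Local Notation sqrt3 := (sqrt3 R).
Local Notation integer := (@integer R).
Local Notation eisenstein := (@eisenstein R).
Local Notation intC := (intr : int -> C).
Implicit Types (z u d : C) (A : set C).

Lemma conj_ratr (r : rat) : (ratr r : C)^*%C = ratr r.
Proof. exact: (fmorph_rat (@conjc R)). Qed.

Lemma conj_integral z : integralOver intC z -> integralOver intC z^*%C.
Proof.
move=> [p pm pz]; exists p => //; rewrite -complex_root_conj.
by rewrite -map_poly_comp (eq_map_poly (fun m => rmorph_int _ m)).
Qed.

Lemma zeta_integral : integralOver intC zeta.
Proof.
exists ('X^2 - 'X + 1).
  rewrite monicE lead_coefDl ?lead_coefDl ?lead_coefXn //.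
    by rewrite size_polyN size_polyX size_polyXn.
  by rewrite size_polyDl ?size_polyN ?size_polyX ?size_polyXn ?size_poly1.
rewrite rootE !rmorphD rmorphN rmorph1 /= map_polyXn map_polyX !hornerE.
by rewrite zeta_sqr; apply/eqP; ring.
Qed.

Lemma sqrtC_sqrt3 : sqrtC (- 3%:R) = sqrt3 \/ sqrtC (- 3%:R) = - sqrt3.
Proof.
have : sqrtC (- 3%:R) ^+ 2 == sqrt3 ^+ 2 by rewrite sqrtCK sqrt3_sqr.
by rewrite eqf_sqr => /orP[] /eqP ->; [left|right].
Qed.

Lemma Qsqrt3P z : Qsqrt 3 z <-> exists a b : rat, z = ratr a + ratr b * sqrt3.
Proof.
rewrite /Qsqrt /=; have [->|->] := sqrtC_sqrt3; first by [].
by split=> -[a [b ->]]; exists a, (- b); rewrite rmorphN /=; ring.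
Qed.

Lemma Qsqrt_ring n : subring (@Qsqrt R n).
Proof.
have s2 := sqrtCK (- n%:R : C); rewrite /Qsqrt; move: (sqrtC _) s2 => s s2.
split.
- by exists 1, 0; rewrite rmorph1 rmorph0 mul0r addr0.
- move=> _ _ [a [b ->]] [c [d ->]]; exists (a - c), (b - d).
  by rewrite !rmorphB /=; ring.
- move=> _ _ [a [b ->]] [c [d ->]]; exists (a * c - b * d * n%:R), (a * d + b * c).
  rewrite !(rmorphB, rmorphD, rmorphM) /= rmorph_nat.
  transitivity (ratr a * ratr c + (ratr a * ratr d + ratr b * ratr c) * s
                + ratr b * ratr d * s ^+ 2); first by ring.
  by rewrite s2; ring.
Qed.

Lemma eisenstein_Qsqrt3 : eisenstein `<=` Qsqrt 3.
Proof.
apply: eisenstein_sub; first exact: Qsqrt_ring.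
apply/Qsqrt3P; exists (1 / 2), (1 / 2); rewrite /sqrt3 fmorph_div rmorph1 rmorph_nat.
by field.
Qed.

(** The ring of integers of Q(sqrt(-3)) is Z[zeta]: traces and norms of integral
    elements are integral rational numbers, hence integers. *)
Lemma ring_of_integers3 : ring_of_integers 3 = eisenstein.
Proof.
have eint : eisenstein `<=` integralOver intC.
  move=> _ [a [b ->]]; apply: integral_add; first exact: integral_id.
  by apply: integral_mul; [exact: integral_id|exact: zeta_integral].
apply/seteqP; split=> z; last by move=> ez; split; [exact: eisenstein_Qsqrt3|exact: eint].
move=> [/Qsqrt3P[a [b zE]] zint].
have zcE : z^*%C = ratr a - ratr b * sqrt3.
  by rewrite zE conjD conj_ratr conjM conj_ratr conj_sqrt3 mulrN.
have zcint := conj_integral zint.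
have sint : integralOver intC sqrt3.
  apply: eint; exists (-1), 2; rewrite /sqrt3; ring.
have s2 := sqrt3_sqr R.
apply: eisenstein_of_traces.
- apply: (@rational_integral _ _ (a + a)); last exact: integral_add.
  by rewrite /reltrace zcE zE rmorphD /=; ring.
- apply: (@rational_integral _ _ (-6 * b)); last first.
    by apply: integral_add; [|apply: conj_integral]; apply: integral_mul.
  rewrite /reltrace conjM zcE conj_sqrt3 zE.
  transitivity (2 * ratr b * sqrt3 ^+ 2 : C); first by ring.
  by rewrite s2 rmorphM rmorphN /= rmorph_nat; ring.
- apply: (@rational_integral _ _ (a ^+ 2 + 3 * b ^+ 2)); last exact: integral_mul.
  rewrite /relnorm zcE zE.
  transitivity (ratr a ^+ 2 - ratr b ^+ 2 * sqrt3 ^+ 2 : C); first by ring.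
  by rewrite s2 rmorphD rmorphM !rmorphXn /= rmorph_nat; ring.
Qed.

Lemma quad_order3 f : quad_order 3 f =
  [set z | exists a b : int, z = a%:~R + f%:R * (b%:~R * zeta)].
Proof.
rewrite /quad_order ring_of_integers3; apply/seteqP; split=> z.
  move=> [m [_ [[a [b ->]] ->]]]; exists (m + f%:Z * a), b.
  by rewrite intrD intrM; ring.
move=> [a [b ->]]; exists a, (b%:~R * zeta); split=> //.
by exists 0, b; rewrite add0r.
Qed.

Lemma quad_order31 : quad_order 3 1 = eisenstein.
Proof.
rewrite quad_order3; apply/seteqP; split=> z [a [b ->]]; exists a, b.
  by rewrite mul1r.
by rewrite mul1r.
Qed.

(** An order containing sqrt(-3) is a subring of Z[zeta] containing 2 zeta: its
    conductor is 1 or 2. *)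
Lemma order_sqrt3 A : subring A -> integral_traces A -> A sqrt3 ->
  exists f, (0 < f)%N /\ A = quad_order 3 f.
Proof.
move=> Ar At As; have AE := sub_eisenstein Ar As At.
have [A1 AB AM] := Ar.
have [Az|nAz] := pselect (A zeta).
  exists 1%N; split=> //; rewrite quad_order31; apply/seteqP; split=> //.
  exact: eisenstein_sub.
exists 2%N; split=> //; rewrite quad_order3.
have A2 : A (2 * zeta) by rewrite -(subrK 1 (2 * zeta)); apply: subringD.
apply/seteqP; split=> z; last first.
  move=> [a [b ->]]; apply: subringD => //; first exact: subring_int.
  have -> : 2%:R * (b%:~R * zeta) = b%:~R * (2 * zeta) by ring.
  by apply: AM => //; apply: subring_int.
move=> Az; have [a [b zE]] := AE _ Az.
move: (divz_eq b 2) (modz_ge0 b (isT : 2 != 0 :> int)).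
have := ltz_pmod b (isT : 0 < 2 :> int).
move: (divz _ 2) (modz _ 2) => k r rlt bE r0.
have [r_0 | r_1] : r = 0 \/ r = 1 by lia.
  exists a, k; rewrite zE bE r_0 addr0 intrM; ring.
case: nAz; suff -> : zeta = z - a%:~R - k%:~R * (2 * zeta).
  by apply: (AB); [apply: (AB) => //|apply: AM => //]; apply: subring_int.
by rewrite zE bE r_1 intrD intrM; ring.
Qed.

Lemma order_zeta A : subring A -> integral_traces A -> A zeta ->
  A = ring_of_integers 3.
Proof.
move=> Ar At Az; have [A1 AB AM] := Ar.
rewrite ring_of_integers3; apply/seteqP; split; last exact: eisenstein_sub.
by apply: sub_eisenstein => //; apply: AB => //; apply: AM => //; apply: (subringD Ar).
Qed.

Lemma End_ring A : is_End_elliptic A -> subring A.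
Proof.
move=> [w1 [w2 [_ ->]]].
have LB x y : lattice w1 w2 x -> lattice w1 w2 y -> lattice w1 w2 (x - y).
  move=> [a [b ->]] [c [d ->]]; exists (a - c), (b - d).
  by rewrite !intrB; ring.
split=> /=.
- by move=> w; rewrite mul1r.
- by move=> x y xA yA w Lw; rewrite mulrBl; apply: LB; [apply: xA|apply: yA].
- by move=> x y xA yA w Lw; rewrite -mulrA; apply/xA/yA.
Qed.

(** Multiplication by z has an integral matrix on a basis of the lattice; as z and
    its conjugate are the eigenvalues of that matrix, Tr z and N z are its trace
    and determinant. *)
Lemma End_traces A : is_End_elliptic A -> integral_traces A.
Proof.
move=> [w1 [w2 [indep ->]]] z zA /=.
have [a [b e1]] : lattice w1 w2 (z * w1).
  by apply: zA; exists 1, 0; rewrite mul0r addr0 mul1r.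
have [c [d e2]] : lattice w1 w2 (z * w2).
  by apply: zA; exists 0, 1; rewrite mul0r add0r mul1r.
have f1 : z^*%C * w1^*%C = a%:~R * w1^*%C + b%:~R * w2^*%C.
  by rewrite -conjM e1 conjD !conjM !rmorph_int.
have f2 : z^*%C * w2^*%C = c%:~R * w1^*%C + d%:~R * w2^*%C.
  by rewrite -conjM e2 conjD !conjM !rmorph_int.
(* If w1 conj(w2) were real then the real combination
   - |w2|^2 w1 + (w1 conj(w2)) w2 would vanish. *)
have D0 : w1 * w2^*%C - w2 * w1^*%C != 0.
  apply/eqP => /eqP; rewrite subr_eq0 => /eqP D0.
  have real (x : C) : x^*%C = x -> x = (complex.Re x)%:C%C.
    by case: x => x y [e]; have -> : y = 0 by lra.
  have r1 : (w1 * w2^*%C)^*%C = w1 * w2^*%C by rewrite conjM conjcK D0 mulrC.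
  have r2 : (- (w2 * w2^*%C))^*%C = - (w2 * w2^*%C).
    by rewrite -[- _]sub0r conjB conjM conjcK conjc0 [_ * w2]mulrC.
  have [] := indep (complex.Re (- (w2 * w2^*%C))) (complex.Re (w1 * w2^*%C)).
    by rewrite -real // -real //; ring.
  move=> z1 _; move: (real _ r2); rewrite z1 => /eqP.
  rewrite oppr_eq0 mulf_eq0 conjc_eq0 orbb => /eqP w20.
  have [] := indep 0 1; first by rewrite w20 mulr0 addr0 mul0r.
  by move=> _ /eqP; rewrite oner_eq0.
split.
- exists (a + d); apply: (mulIf D0); rewrite intrD /reltrace.
  transitivity ((z * w1) * w2^*%C - (z * w2) * w1^*%C
                + (z^*%C * w2^*%C) * w1 - (z^*%C * w1^*%C) * w2); first by ring.
  by rewrite e1 e2 f1 f2; ring.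
- exists (a * d - b * c); apply: (mulIf D0); rewrite intrB !intrM /relnorm.
  transitivity ((z * w1) * (z^*%C * w2^*%C) - (z * w2) * (z^*%C * w1^*%C)); first by ring.
  by rewrite e1 e2 f1 f2; ring.
Qed.

End Rings.

(** * Two by two matrices *)

Section Matrices.
Variable F : comNzRingType.
Implicit Types (a b g h : 'M[F]_2).

Lemma mul2E a b i j : (a * b) i j = a i 0 * b 0 j + a i 1 * b 1 j.
Proof.
rewrite -mulmxE mxE !big_ord_recl big_ord0 addr0.
by congr (_ + a i _ * b _ j); apply: val_inj.
Qed.

Lemma mx2P a b : a 0 0 = b 0 0 -> a 0 1 = b 0 1 -> a 1 0 = b 1 0 ->
  a 1 1 = b 1 1 -> a = b.
Proof.
move=> e00 e01 e10 e11; apply/matrixP => i j.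
have I2 (k : 'I_2) : k = 0 \/ k = 1.
  by case: k => -[|[|//]] lt; [left|right]; apply: val_inj.
by case: (I2 i) => ->; case: (I2 j) => ->.
Qed.

Lemma tr2E a : \tr a = a 0 0 + a 1 1.
Proof.
rewrite /mxtrace !big_ord_recl big_ord0 addr0.
by congr (_ + a _ _); apply: val_inj.
Qed.

Lemma det2E a : \det a = a 0 0 * a 1 1 - a 0 1 * a 1 0.
Proof.
rewrite (expand_det_row _ 0) !big_ord_recl big_ord0 /cofactor !det_mx11 !mxE /=.
have -> : lift 0 0 = 1 :> 'I_2 by apply: val_inj.
have -> : lift 1 0 = 0 :> 'I_2 by apply: val_inj.
by rewrite addr0 expr0 mul1r expr1 mulN1r mulrN.
Qed.

Lemma mx2_CH a : a * a = \tr a *: a - (\det a)%:M.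
Proof.
by rewrite tr2E det2E; apply: mx2P; rewrite mul2E !mxE /=; ring.
Qed.

Lemma mx2_det_sub_scalar a (c : F) :
  \det (a - c%:M) = c ^+ 2 - \tr a * c + \det a.
Proof. by rewrite !det2E tr2E !mxE /=; ring. Qed.

(** For a of rank one this says that a h a is a multiple of a, which is why a matrix
    commuting with a projection of rank one acts on its image by a scalar. *)
Lemma mx2_sandwich a h :
  a * h * a = \tr (a * h) *: a - \det a *: ((\tr h)%:M - h).
Proof.
by rewrite !tr2E det2E; apply: mx2P; rewrite !(mul2E, mxE) /=; ring.
Qed.

End Matrices.

Lemma mx2_char_poly (F : comNzRingType) (a : 'M[F]_2) :
char_poly a = 'X^2 - \tr a *: 'X + (\det a)%:P.
Proof.
rewrite /char_poly /char_poly_mx !det2E tr2E !mxE /= !(polyCD, polyCN, polyCM) -mul_polyC.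
by rewrite polyCD; ring.
Qed.

Section Split.
Variable F : fieldType.
Implicit Types (g h : 'M[F]_2) (u v : F).

(** The trace condition says that the projection has rank one. *)
Definition idem1 (e : 'M[F]_2) := e * e = e /\ \tr e = 1.

(** The matrix with eigenvalues u on the image of the projection e, and v on its
    kernel. *)
Definition spec (e : 'M[F]_2) u v := u *: e + v *: (1 - e).

Lemma idem1_det e : idem1 e -> \det e = 0.
Proof.
move=> [ee te]; have := mx2_CH e; rewrite ee te scale1r => /eqP.
rewrite -subr_eq0 opprB addrC subrK => /eqP/matrixP/(_ 0 0).
by rewrite !mxE.
Qed.

Lemma idem1C e : idem1 e -> idem1 (1 - e).
Proof.
move=> [ee te]; split; first by rewrite mulrBr mulr1 mulrBl mul1r ee subrr subr0.
by rewrite mxtraceD raddfN /= te mxtrace1 [1 + 1 - 1](addrK 1 1).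
Qed.

Lemma specC e u v : spec e u v = spec (1 - e) v u.
Proof. by rewrite /spec subKr addrC. Qed.

Section OneIdempotent.
Variable e : 'M[F]_2.
Hypothesis eP : idem1 e.

Lemma specM u v u' v' : spec e u v * spec e u' v' = spec e (u * u') (v * v').
Proof.
have [ee _] := eP.
have e1 : e * (1 - e) = 0 by rewrite mulrBr mulr1 ee subrr.
have e2 : (1 - e) * e = 0 by rewrite mulrBl mul1r ee subrr.
have e3 : (1 - e) * (1 - e) = 1 - e by rewrite mulrBr mulr1 e2 subr0.
rewrite /spec mulrDl !mulrDr -!scalerAl -!scalerAr ee e1 e2 e3 !scaler0.
by rewrite addr0 add0r !scalerA.
Qed.

Lemma spec_scalar u : spec e u u = u%:M.
Proof. by rewrite /spec -scalerDr addrC subrK scalemx1. Qed.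

Lemma specX u v k : spec e u v ^+ k = spec e (u ^+ k) (v ^+ k).
Proof.
elim: k => [|k IH]; first by rewrite !expr0 spec_scalar.
by rewrite !exprS IH specM.
Qed.

Lemma spec_tr u v : \tr (spec e u v) = u + v.
Proof.
have [_ te] := eP.
rewrite /spec mxtraceD !mxtraceZ mxtraceD raddfN /= te mxtrace1 mulr1.
by rewrite [1 + 1 - 1](addrK 1 1) mulr1.
Qed.

Lemma specB u v u' v' : spec e (u - u') (v - v') = spec e u v - spec e u' v'.
Proof. by rewrite /spec !scalerBl addrACA -opprD. Qed.

Lemma specZ c u v : c *: spec e u v = spec e (c * u) (c * v).
Proof. by rewrite /spec scalerDr !scalerA. Qed.

Lemma spec_inj u v u' v' : spec e u v = spec e u' v' -> u = u' /\ v = v'.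
Proof.
have key w z : spec e w z = 0 -> w = 0.
  move=> z0; have := spec_tr (w * 1) (z * 0).
  by rewrite -specM z0 mul0r mxtrace0 mulr1 mulr0 addr0.
have key' w z : spec e w z = 0 -> z = 0.
  by move=> z0; have := spec_tr w z; rewrite z0 mxtrace0 (key _ _ z0) add0r.
move=> E; have E0 : spec e (u - u') (v - v') = 0.
  by rewrite specB E subrr.
by split; apply/eqP; rewrite -subr_eq0; apply/eqP; [exact: key E0|exact: key' E0].
Qed.

(** The determinant is read off the Cayley-Hamilton equation, in which the square
    is already known. *)
Lemma spec_det u v : \det (spec e u v) = u * v.
Proof.
have E := mx2_CH (spec e u v); rewrite specM spec_tr specZ in E.
have : spec e ((u + v) * u - u * u) ((u + v) * v - v * v) = (\det (spec e u v))%:M.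
  by rewrite specB E opprB addrC subrK.
by rewrite -(spec_scalar (\det _)) => /spec_inj[<- _]; ring.
Qed.

Lemma spec_comm h : h * e = e * h -> exists u v, h = spec e u v.
Proof.
move=> he; have [ee te] := eP.
have sandwich f : idem1 f -> f * h = h * f -> h * f = \tr (f * h) *: f.
  move=> fP fh; have [ff _] := fP.
  by have := mx2_sandwich f h; rewrite fh -mulrA ff (idem1_det fP) scale0r subr0.
have fP := idem1C eP.
exists (\tr (e * h)), (\tr ((1 - e) * h)).
rewrite /spec -!sandwich //; last by rewrite mulrBl mulrBr he mul1r mulr1.
by rewrite -mulrDr addrC subrK mulr1.
Qed.

End OneIdempotent.
End Split.

(** * Elements of order three and their normalizers *)

Lemma cube_root_faithful (U : unitRingType) (x : U) a c :
  x ^+ 3 = 1 -> x <> 1 -> x ^+ a = x ^+ c -> a = c %[mod 3].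
Proof.
move=> x3 x1; have xU := unit_of_exp (ltn0Sn 2) x3.
rewrite -(expr_mod a x3) -(expr_mod c x3).
move: (a %% 3)%N (c %% 3)%N (ltn_pmod a (ltn0Sn 2)) (ltn_pmod c (ltn0Sn 2)).
have x2 : x ^+ 2 <> 1 by move=> e; apply: x1; rewrite -x3 exprS e mulr1.
have x12 : x <> x ^+ 2.
  by move=> e; apply: x1; apply: (mulrI xU); rewrite mulr1 -expr2.
by move=> [|[|[|//]]] [|[|[|//]]] _ _ //; rewrite ?expr0 ?expr1;
   first [move/x1 | move/esym/x1 | move/x2 | move/esym/x2 | move/x12 | move/esym/x12].
Qed.

Section GL2.
Variable R : realType.
Local Notation C := R[i].
Local Notation zeta := (zeta R).
Local Notation sqrt3 := (sqrt3 R).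
Implicit Types (A : set C) (e g h c : 'M[C]_2) (u v : C) (k n : nat).

Lemma matrix_unit g : \det g != 0 -> g \is a GRing.unit.
Proof. by move=> d0; rewrite unitmxE unitfE. Qed.

Lemma det_mul g h : \det (g * h) = \det g * \det h.
Proof. exact: det_mulmx. Qed.

Lemma det_exp g k : \det (g ^+ k) = \det g ^+ k.
Proof. by elim: k => [|k IH]; rewrite ?expr0 ?det1 // !exprS det_mul IH. Qed.

Lemma det_scalar2 u : \det (u%:M : 'M[C]_2) = u ^+ 2.
Proof. exact: det_scalar. Qed.

Lemma trace_mulC g h : \tr (g * h) = \tr (h * g).
Proof. exact: mxtrace_mulC. Qed.

Lemma eigenvaluesI h u v : \tr h = u + v -> \det h = u * v -> eigenvalues h u v.
Proof.
move=> ht hd; rewrite /eigenvalues mx2_char_poly ht hd polyCM -mul_polyC polyCD.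
by ring.
Qed.

Lemma spec_eigenvalues e u v : idem1 e -> eigenvalues (spec e u v) u v.
Proof. by move=> eP; apply: eigenvaluesI; rewrite ?spec_tr ?spec_det. Qed.

Lemma zeta_eq i k : i = k %[mod 6] -> zeta ^+ i = zeta ^+ k.
Proof. by move/eqP; rewrite -(eq_prim_root_expr (zeta_prim R)) => /eqP. Qed.

Lemma zeta_exp1 k : (6 %| k)%N -> zeta ^+ k = 1.
Proof. by rewrite (prim_order_dvd (zeta_prim R)) => /eqP. Qed.

Lemma zetaX_exp1 i k : (6 %| i * k)%N -> (zeta ^+ i) ^+ k = 1.
Proof. by rewrite -exprM; apply: zeta_exp1. Qed.

Lemma spec_zeta_exp6 e i k : idem1 e ->
  spec e (zeta ^+ i) (zeta ^+ k) ^+ 6 = 1.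
Proof.
by move=> eP; rewrite specX // !zetaX_exp1 ?dvdn_mull // spec_scalar.
Qed.

Lemma zeta4 : zeta ^+ 4 = - zeta.
Proof. by rewrite exprS zeta3 mulrN1. Qed.

Lemma zeta5 : zeta ^+ 5 = 1 - zeta.
Proof. by rewrite exprS zeta4 mulrN -expr2 zeta_sqr opprB. Qed.

Lemma expiX (t : R) k : expi t ^+ k = expi (t *+ k).
Proof.
by elim: k => [|k IH]; rewrite ?expr0 ?mulr0n ?expi0 // exprS IH -expiD mulrS.
Qed.

Lemma expi_23 : expi (2 * pi / 3) = zeta ^+ 2.
Proof. by rewrite zetaE expiX; congr expi; rewrite mulr2n; field. Qed.

Lemma expi_n3 : expi (- (pi / 3)) = zeta ^+ 5.
Proof. by rewrite -conj_expi -zetaE conj_zeta zeta5. Qed.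

Lemma expi_n23 : expi (- (2 * pi / 3)) = zeta ^+ 4.
Proof.
have -> : - (2 * pi / 3) = (- (pi / 3)) *+ 2 :> R by rewrite mulr2n; field.
by rewrite -expiX expi_n3 -exprM; apply: zeta_eq.
Qed.

(** Reducing g^3 = 1 by the Cayley-Hamilton equation gives
    (t + 1) ((t - 1) g - 1) = 0 with t = tr g; if t <> -1 then g is a scalar, of
    square 1 and cube 1. *)
Lemma order3_trace g : g ^+ 3 = 1 -> \det g = 1 -> g <> 1 -> \tr g = -1.
Proof.
move=> g3 gd g1; have CH := mx2_CH g; rewrite gd in CH; set t := \tr g in CH *.
have E : (t + 1) *: ((t - 1) *: g - 1) = 0.
  have : g ^+ 3 = t *: (t *: g - 1) - g.
    by rewrite !exprS expr0 mulr1 CH mulrBr mulr1 -scalerAr CH.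
  rewrite g3 => /eqP; rewrite -subr_eq0 => /eqP E.
  by rewrite -[RHS]oppr0 -E; apply/matrixP => i j; rewrite !mxE; ring.
have [t0|t0] := eqVneq (t + 1) 0; first by apply/eqP; rewrite -addr_eq0 t0.
move/eqP: E; rewrite scaler_eq0 (negPf t0) /= subr_eq0 => /eqP E.
have t2 : t - 1 = 1 \/ t - 1 = -1.
  have := detZ (t - 1) g; rewrite E [\det 1]det1 gd mulr1.
  by move/esym/eqP; rewrite sqrf_eq1 => /orP[] /eqP; [left|right].
case: t2 E => ->; first by rewrite scale1r => /g1.
rewrite scaleN1r => E; have gN : g = -1 by rewrite -E opprK.
move: g3; rewrite gN exprNn expr1n mulr1 -signr_odd expr1.
by move/matrixP/(_ 0 0)/eqP; rewrite !mxE /= eqNr oner_eq0.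
Qed.

(** An element of determinant 1 and trace -1 is diagonalizable with the primitive
    cube roots of unity as eigenvalues; these are distinct, so the projection on
    an eigenspace is a polynomial in g, and it commutes with whatever commutes
    with g. *)
Lemma trace_spec g : \det g = 1 -> \tr g = -1 ->
  exists e, [/\ idem1 e, g = spec e (zeta ^+ 2) (zeta ^+ 4) &
                forall h, h * g = g * h -> exists u v, h = spec e u v].
Proof.
move=> gd gt; have s2 := sqrt3_sqr R.
have s0 : sqrt3 != 0.
  by rewrite -sqrf_eq0 s2 oppr_eq0 pnatr_eq0.
have se : zeta ^+ 2 - zeta ^+ 4 = sqrt3 by rewrite zeta_sqr zeta4 /sqrt3; ring.
pose e := sqrt3^-1 *: (g - (zeta ^+ 4)%:M).
have te : \tr e = 1.
  rewrite mxtraceZ mxtraceD raddfN /= mxtrace_scalar gt zeta4.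
  by apply: (canLR (mulKf s0)); rewrite /sqrt3; ring.
have de : \det e = 0.
  rewrite detZ mx2_det_sub_scalar gt gd zeta4 sqrrN zeta_sqr.
  ring.
have eP : idem1 e by split=> //; rewrite mx2_CH te de scale1r raddf0 subr0.
have gE : g = sqrt3 *: e + (zeta ^+ 4)%:M.
  by rewrite scalerA divff // scale1r subrK.
have comm h : h * g = g * h -> h * e = e * h.
  move=> hg; rewrite /e -scalerAr -scalerAl mulrBr mulrBl hg; congr (_ *: (_ - _)).
  by rewrite -scalemx1 -scalerAr -scalerAl mulr1 mul1r.
clearbody e; exists e; split=> // [|h /comm]; last exact: spec_comm.
rewrite gE -se /spec -scalemx1 scalerBl scalerBr.
by rewrite -addrA; congr (_ + _); rewrite addrC.
Qed.

Lemma trace_order3 g : \det g = 1 -> \tr g = -1 -> g ^+ 3 = 1 /\ g <> 1.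
Proof.
move=> gd gt; split.
  have [e [eP -> _]] := trace_spec gd gt.
  by rewrite specX // !zetaX_exp1 // spec_scalar.
move=> g1; move/eqP: gt; rewrite g1 mxtrace1 -subr_eq0 opprK.
have -> : 2%:R + 1 = 3%:R :> C by ring.
by rewrite pnatr_eq0.
Qed.

Lemma trace_quadratic g : \det g = 1 -> \tr g = -1 -> 1 + g + g ^+ 2 = 0.
Proof.
move=> gd gt; rewrite expr2 mx2_CH gd gt scaleN1r.
by rewrite -opprD [g + _]addrC subrr.
Qed.

(** If h inverts g then the traces of h g and h g^2 coincide, so that
    1 + g + g^2 = 0 gives tr h = -2 tr (h g); the same holds for h g. *)
Lemma inverting_trace g h : \det g = 1 -> \tr g = -1 -> h * g = g ^+ 2 * h ->
  \tr h = 0.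
Proof.
move=> gd gt.
have key c : c * g = g ^+ 2 * c -> \tr c = - 2 * \tr (c * g).
  move=> cg; have : \tr (c * (1 + g + g ^+ 2)) = 0.
    by rewrite trace_quadratic // mulr0 mxtrace0.
  rewrite !mulrDr mulr1 !mxtraceD (trace_mulC c (g ^+ 2)) -cg -addrA => /eqP.
  by rewrite addr_eq0 => /eqP ->; ring.
move=> hg; have hgg : h * g * g = g ^+ 2 * (h * g) by rewrite [in LHS]hg mulrA.
have tE : \tr (h * g * g) = \tr (h * g) by rewrite -mulrA -expr2 trace_mulC -hg.
have := key _ hgg; rewrite tE => /eqP; rewrite -subr_eq0.
have -> : \tr (h * g) - -2 * \tr (h * g) = 3 * \tr (h * g) by ring.
rewrite mulf_eq0 pnatr_eq0 /= => /eqP t0.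
by rewrite (key _ hg) t0 mulr0.
Qed.

Lemma inverting_sqr g h : \det g = 1 -> \tr g = -1 -> h * g = g ^+ 2 * h ->
  h ^+ 2 = (- \det h)%:M.
Proof.
move=> gd gt hg; rewrite expr2 mx2_CH (inverting_trace gd gt hg) scale0r sub0r.
by rewrite raddfN.
Qed.

(** The determinant separates the exponents of h. *)
Lemma faithful_det g h n : g ^+ 3 = 1 -> g <> 1 -> \det g = 1 ->
  n.-primitive_root (\det h) -> h ^+ n = 1 ->
  faithful 3 n (fun a b => g ^+ a * h ^+ b).
Proof.
move=> g3 g1 gd hp hn a b c d E.
have hU := unit_of_exp (prim_order_gt0 hp) hn.
have bd : b = d %[mod n].
  apply/eqP; rewrite -(eq_prim_root_expr hp); apply/eqP.
  by move/(congr1 determinant): E; rewrite !det_mul !det_exp gd !expr1n !mul1r.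
split=> //; apply: cube_root_faithful g3 g1 _.
move: E; rewrite -(expr_mod b hn) bd expr_mod //.
by move/mulIr; apply; rewrite unitrX.
Qed.

Lemma has_order_det h n : n.-primitive_root (\det h) -> h ^+ n = 1 -> has_order h n.
Proof.
move=> hp hn; split=> [||m m0 hm]; [exact: prim_order_gt0 hp|by []|].
apply: dvdn_leq => //; rewrite (prim_order_dvd hp) -det_exp hm; apply/eqP; exact: det1.
Qed.

Lemma has_order3 g : g ^+ 3 = 1 -> g <> 1 -> has_order g 3.
Proof.
move=> g3 g1; split=> // m m0 gm; apply: dvdn_leq => //.
by apply/eqP/(@cube_root_faithful _ g m 0%N).
Qed.

Lemma prim2 : 2.-primitive_root (-1 : C).
Proof. by have := exp_prim_root (zeta_prim R) 3; rewrite zeta3. Qed.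

Lemma prim6 i : coprime i 6 -> 6.-primitive_root (zeta ^+ i).
Proof. by rewrite (prim_root_exp_coprime _ (zeta_prim R)). Qed.

Lemma prim3 i : gcdn i 6 = 2 -> 3.-primitive_root (zeta ^+ i).
Proof. by move=> g2; have := exp_prim_root (zeta_prim R) i; rewrite g2. Qed.

(** Closure under inverses is the formula x^-1 = (det x)^-1 (tr x - x). *)
Lemma GL2_group A : subring A -> is_group (GL2 A).
Proof.
move=> Ar; have [A1 AB AM] := Ar.
have A0 : A 0 by apply: subring0.
have one i j : A ((1 : 'M[C]_2) i j).
  by rewrite !mxE; case: (i == j).
have unit h : ring_units A (\det h) -> h \is a GRing.unit.
  move=> [_ [v [_ dv]]]; apply: matrix_unit; apply/eqP => d0.
  by move/eqP: dv; rewrite d0 mul0r eq_sym oner_eq0.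
split.
- by move=> h [_ hd]; apply: unit.
- by split=> //; rewrite det1; split=> //; exists 1; rewrite mulr1.
- move=> x y [xA [dx [v [Av xv]]]] [yA [dy [w [Aw yw]]]]; split.
    by move=> i j; rewrite mul2E; apply: (subringD Ar); apply: AM.
  rewrite det_mul; split; first exact: AM.
  by exists (v * w); split; [exact: AM|rewrite mulrACA xv yw mulr1].
- move=> x [xA xd]; have xU := unit _ xd; case: xd => [dx [v [Av xv]]].
  have xVE : x^-1 = v *: ((\tr x)%:M - x).
    apply: (mulrI xU); rewrite divrr // -scalerAr mulrBr mx2_CH.
    rewrite -[(\tr x)%:M]scalemx1 -scalerAr mulr1 opprB addrCA subrr addr0.
    by rewrite -scalemx1 scalerA mulrC xv scale1r.
  have txA : A (\tr x) by rewrite tr2E; apply: (subringD Ar).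
  split.
    move=> i j; rewrite xVE !mxE; apply: AM => //; apply: AB => //.
    by case: (i == j); rewrite ?mulr1n ?mulr0n.
  have -> : \det x^-1 = v.
    have dn : \det x != 0.
      by apply/eqP => d0; move/eqP: xv; rewrite d0 mul0r eq_sym oner_eq0.
    by apply: (mulfI dn); rewrite xv -det_mul divrr // [LHS]det1.
  by split=> //; exists (\det x); rewrite mulrC.
Qed.

End GL2.

(** * The groups of the list *)

Section Types.
Variable R : realType.
Local Notation C := R[i].
Local Notation zeta := (zeta R).
Local Notation sqrt3 := (sqrt3 R).
Implicit Types (A : set C) (e g h c : 'M[C]_2) (u v : C).

Lemma HC3_1_cyclic A e c : (exists f, (0 < f)%N /\ A = quad_order 3 f) ->
  GL2 A c -> idem1 e -> c = spec e zeta (zeta ^+ 2) -> HC3_1 A (gen_grp [set c]).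
Proof.
move=> Af cA eP cE; split=> //; exists c.
have c6 : c ^+ 6 = 1.
  by rewrite cE; apply: (spec_zeta_exp6 1).
have cX i j : c ^+ i = c ^+ j -> i = j %[mod 6].
  rewrite cE !specX // => /spec_inj[]// /eqP.
  by rewrite (eq_prim_root_expr (zeta_prim R)) => /eqP.
split=> //.
- by split=> // m m0 cm; apply: dvdn_leq => //; apply/eqP/(cX m 0%N).
- have -> : gen_grp [set c] = words 1 c.
    rewrite (gen_grp1 (isT : 0 < 6)%N c6); apply/seteqP.
    split=> [_ [b ->]|_ [a [b ->]]]; first by exists 0%N, b; rewrite mul1r.
    by exists b; rewrite expr1n mul1r.
  apply: words_Cyc => // a b a' b'; rewrite !expr1n !mul1r => /cX.
  by rewrite !modn1.
- by rewrite expi_23; rewrite -zetaE cE; apply: spec_eigenvalues.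
Qed.

Lemma S3_words g h : \det g = 1 -> g ^+ 3 = 1 -> g <> 1 -> h ^+ 2 = 1 ->
  \det h = -1 -> h * g = g ^+ 2 * h ->
  presented 2 g h (words g h) /\ isom_fin (words g h) [group of [set: 'S_3]].
Proof.
move=> gd g3 g1 h2 hd hg.
have fgh : faithful 3 2 (fun a b => g ^+ a * h ^+ b).
  by apply: faithful_det => //; rewrite hd; apply: prim2.
by split; [apply: words_presented|apply: words_S3].
Qed.

Lemma HC3_2_words A g h : SL2 A g -> g ^+ 3 = 1 -> g <> 1 -> GL2 A h ->
  \det h = -1 -> h * g = g ^+ 2 * h -> HC3_2 A (words g h).
Proof.
move=> gS g3 g1 hA hd hg; have gd : \det g = 1 by case: gS.
have gt := order3_trace g3 gd g1.
have h2 : h ^+ 2 = 1 by rewrite (inverting_sqr gd gt hg) hd opprK.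
have [pr iso] := S3_words gd g3 g1 h2 hd hg.
exists g, h; split=> //.
- by split=> //; apply: has_order3.
- by split=> //; apply: has_order_det => //; rewrite hd; apply: prim2.
- by apply: eigenvaluesI; rewrite ?(inverting_trace gd gt hg) ?hd; ring.
Qed.

Lemma scalar_comm g u : u%:M * g = g * u%:M.
Proof. by rewrite -scalemx1 -scalerAl -scalerAr mul1r mulr1. Qed.

Lemma scalarX u k : (u%:M : 'M[C]_2) ^+ k = (u ^+ k)%:M.
Proof.
elim: k => [|k IH]; first by rewrite !expr0.
by rewrite !exprS IH -[_ * _]scalar_mxM.
Qed.

(** The scalar meets <g> trivially since the nontrivial powers of zeta^2 I have
    determinant different from 1. *)
Lemma HC3_3_words A g : A = ring_of_integers 3 -> SL2 A g -> \tr g = -1 ->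
  HC3_3_of A g (words g (zeta ^+ 2)%:M).
Proof.
move=> AE gS gt; have gd : \det g = 1 by case: gS.
have [g3 g1] := trace_order3 gd gt.
have w3 : ((zeta ^+ 2)%:M : 'M[C]_2) ^+ 3 = 1.
  by rewrite scalarX -exprM (@zeta_eq _ _ 0%N).
have f3 : faithful 3 3 (fun a b => g ^+ a * (zeta ^+ 2)%:M ^+ b).
  by apply: faithful_det => //; rewrite det_scalar2 -exprM; apply: prim3.
split=> //; rewrite ?expi_23.
- by apply: words_direct_product (f3) (scalar_comm _ _).
- by apply: words_Cyc_prod => //; apply: scalar_comm.
Qed.

Lemma HC3_4_words A e g c : A = ring_of_integers 3 -> SL2 A g ->
  g ^+ 3 = 1 -> g <> 1 -> GL2 A c -> c * g = g * c ->
  idem1 e -> c = spec e zeta (zeta ^+ 4) -> HC3_4 A (words g c).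
Proof.
move=> AE gS g3 g1 cA cg eP cE; have gd : \det g = 1 by case: gS.
have cd : \det c = zeta ^+ 5 by rewrite cE spec_det // -exprS.
have cp : 6.-primitive_root (\det c) by rewrite cd; apply: prim6.
have c6 : c ^+ 6 = 1.
  by rewrite cE; apply: (spec_zeta_exp6 1).
have f6 := faithful_det g3 g1 gd cp c6.
split=> //; exists g, c; split.
- by split=> //; apply: has_order3.
- by split=> //; apply: has_order_det.
- exact: words_direct_product f6 cg.
- exact: words_Cyc_prod.
- by rewrite expi_n23 -zetaE cE; apply: spec_eigenvalues.
Qed.

(** As h^2 = -zeta, the matrix h has order 6, like its determinant. *)
Lemma order18_words g h : \det g = 1 -> g ^+ 3 = 1 -> g <> 1 ->
  \det h = zeta -> h * g = g ^+ 2 * h ->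
  [/\ h ^+ 6 = 1, presented 6 g h (words g h) & words g h #= `I_18].
Proof.
move=> gd g3 g1 hd hg; have gt := order3_trace g3 gd g1.
have h6 : h ^+ 6 = 1.
  rewrite (exprM _ 2 3) (inverting_sqr gd gt hg) hd scalarX.
  by rewrite exprNn zeta3 -signr_odd expr1 mulrNN mulr1.
have f6 : faithful 3 6 (fun a b => g ^+ a * h ^+ b).
  by apply: faithful_det => //; rewrite hd; apply: zeta_prim.
by split=> //; [apply: words_presented|apply: (words_card (m := 3) (n := 6))].
Qed.

Lemma HC3_5_words A g h : A = ring_of_integers 3 -> SL2 A g ->
  g ^+ 3 = 1 -> g <> 1 -> GL2 A h -> \det h = zeta -> h * g = g ^+ 2 * h ->
  HC3_5 A (words g h).
Proof.
move=> AE gS g3 g1 hA hd hg; have gd : \det g = 1 by case: gS.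
have [h6 pr card] := order18_words gd g3 g1 hd hg.
split=> //; exists g, h; split=> //.
- by split=> //; apply: has_order3.
- by split=> //; apply: has_order_det => //; rewrite hd; apply: zeta_prim.
- rewrite expi_23 expi_n3; apply: eigenvaluesI.
    rewrite (inverting_trace gd (order3_trace g3 gd g1) hg).
    by rewrite zeta_sqr zeta5; ring.
  by rewrite hd -exprD (@zeta_eq _ _ 1%N) // expr1.
Qed.

End Types.

(** * The classification *)

(** A group generated by 1 is trivial, so not isomorphic to a larger cyclic one. *)
Lemma isom_Cyc_generator_neq1 (U : unitRingType) (d : U) s :
  (1 < s)%N -> isom_fin (gen_grp [set d]) (Cyc s) -> d <> 1.
Proof.
move=> s1 [f [[fK finj _] _]] d1.
have trivial x : gen_grp [set d] x -> x = 1.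
  by rewrite (gen_grp1 (isT : 0 < 1)%N (d1 : d ^+ 1 = 1)) => -[b ->]; rewrite d1 expr1n.
have fC t : f t = 1 by apply: trivial; apply: fK; rewrite /= mem_Cyc.
have /eqP : (Zp1 : 'Z_s) = 1%g.
  by apply: finj; rewrite ?fC //; apply/mem_set; rewrite /= mem_Cyc.
by rewrite -order_eq1 Zp1_order // gtn_eqF.
Qed.

Lemma isom_Cyc_expn (U : unitRingType) (K : set U) (x : U) s :
  (1 < s)%N -> K `<=` [set y | y \is a GRing.unit] -> isom_fin K (Cyc s) -> K x ->
  x ^+ s = 1.
Proof.
move=> s1 KU [f [[fK _ fsurj] fM]] /fsurj[t tC <-].
have C1 := @group1 _ (Cyc s).
have f1 : f 1%g = 1.
  have fU : f 1%g \is a GRing.unit by apply/KU/fK.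
  by apply: (mulrI fU); rewrite -fM // mulg1 mulr1.
have fX k : f (t ^+ k)%g = f t ^+ k.
  elim: k => [|k IH]; first by rewrite expg0 f1 expr0.
  by rewrite expgS fM ?groupX // IH exprS.
by rewrite -fX; have := expg_cardG tC; rewrite Cyc_card // => ->.
Qed.

Section Classification.
Variable R : realType.
Local Notation C := R[i].
Local Notation zeta := (zeta R).
Local Notation sqrt3 := (sqrt3 R).
Variables (A : set C) (H : set 'M[C]_2) (g : 'M[C]_2).
Hypotheses (Ar : subring A) (At : integral_traces A).
Hypotheses (Hgrp : is_group H) (HA : H `<=` GL2 A).
Hypothesis HSL : H `&` SL2 A = gen_grp [set g].
Hypotheses (g3 : g ^+ 3 = 1) (g1 : g <> 1).
Implicit Types (h k x : 'M[C]_2) (u v d : C).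

Lemma SL_gen x : H x -> \det x = 1 -> exists a, x = g ^+ a.
Proof.
move=> Hx dx; have : (H `&` SL2 A) x by split=> //; split=> //; apply: HA.
by rewrite HSL (gen_grp1 _ g3).
Qed.

Lemma g_in : H g /\ SL2 A g.
Proof.
suff : (H `&` SL2 A) g by [].
by rewrite HSL; apply: sub_gen_smallest.
Qed.

Let gH := g_in.1.
Let gS := g_in.2.

Lemma g_det : \det g = 1.
Proof. by case: gS. Qed.

Let gd := g_det.
Let gt := order3_trace g3 gd g1.

Lemma HM x y : H x -> H y -> H (x * y).
Proof. by case: Hgrp => _ _ HM _; apply: HM. Qed.

Lemma HX x n : H x -> H (x ^+ n).
Proof. exact: group_exp. Qed.

Lemma H_tr x : H x -> A (\tr x).
Proof. by move=> /HA[xA _]; rewrite tr2E; apply: subringD. Qed.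

Lemma H_det x : H x -> A (\det x).
Proof. by move=> /HA[_ []]. Qed.

(** The matrix -1 has determinant 1, and it is not in <g> because its cube is -1. *)
Lemma H_neg1 : ~ H (-1).
Proof.
move=> /SL_gen[|a aE].
  by rewrite -[-1]scaleN1r detZ det1 mulr1 sqrrN expr1n.
have : (-1 : 'M[C]_2) ^+ 3 = 1 by rewrite aE -exprM mulnC exprM g3 expr1n.
rewrite -signr_odd expr1 => /matrixP/(_ 0 0)/eqP.
by rewrite !mxE /= eqNr oner_eq0.
Qed.

(** Any element whose determinant generates det H generates H together with g. *)
Lemma H_words k : H k -> (forall x, H x -> exists j, \det x = \det k ^+ j) ->
  H = words g k.
Proof.
move=> Hk Hdet; have [HU _ _ HV] := Hgrp; have kU : k \is a GRing.unit := HU _ Hk.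
apply/seteqP; split=> [x Hx|_ [a [b ->]]]; last by apply: HM; apply: HX.
have [j xj] := Hdet _ Hx; have kjU := unitrX j kU.
have [||a E] := @SL_gen (x * (k ^+ j)^-1); first by apply/HM/HV/HX.
  rewrite det_mul xj -(det_exp k j) -det_mul divrr //; exact: det1.
by exists a, j; rewrite -E divrK.
Qed.

(** An involution of determinant -1 commuting with g has eigenvalues 1 and -1 on
    the eigenlines of g, so tr (g k) is, up to sign, the difference sqrt(-3) of
    the eigenvalues of g. *)
Lemma involution_sqrt3 e k : idem1 e -> g = spec e (zeta ^+ 2) (zeta ^+ 4) ->
  (forall x, x * g = g * x -> exists u v, x = spec e u v) ->
  H k -> k * g = g * k -> k ^+ 2 = 1 -> \det k = -1 ->
  A sqrt3 /\ (k = spec e 1 (-1) \/ k = spec e (-1) 1).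
Proof.
move=> eP gE ec Hk kg k2 kd; have [u [v kE]] := ec _ kg.
have [u2 v2] : u ^+ 2 = 1 /\ v ^+ 2 = 1.
  by apply: (spec_inj eP); rewrite -(specX eP) -kE k2 spec_scalar.
have uv : u * v = -1 by rewrite -(spec_det eP) -kE.
have trA : A (\tr (g * k)) by apply/H_tr/HM.
have ue : u = 1 \/ u = -1.
  by move/eqP: u2; rewrite sqrf_eq1 => /orP[] /eqP; [left|right].
rewrite gE kE (specM eP) (spec_tr eP) zeta_sqr zeta4 in trA.
case: ue => ue; rewrite {}ue in uv kE trA.
  have ve : v = -1 by rewrite -uv mul1r.
  rewrite ve in kE trA; split; last by left.
  by have -> : sqrt3 = (zeta - 1) * 1 + - zeta * -1 by rewrite /sqrt3; ring.
have ve : v = 1 by apply: oppr_inj; rewrite -uv mulN1r.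
rewrite ve in kE trA; split; last by right.
have -> : sqrt3 = - ((zeta - 1) * -1 + - zeta * 1) by rewrite /sqrt3; ring.
exact: subringN.
Qed.

(** The diagonal matrix with entries (u v)^2 / u and (u v)^2 / v has determinant 1
    and cube roots of unity as entries, so it is a power of g; its product with h
    is the scalar (u v)^2. *)
Lemma scalar_in_H e h u v : idem1 e -> g = spec e (zeta ^+ 2) (zeta ^+ 4) ->
  H h -> h = spec e u v -> u ^+ 3 = 1 -> v ^+ 3 = 1 -> H ((u * v) ^+ 2)%:M.
Proof.
move=> eP gE Hh hE u3 v3; pose w := u ^+ 4 * v ^+ 2.
have w3 : w ^+ 3 = 1.
  have -> : w ^+ 3 = (u ^+ 3) ^+ 4 * (v ^+ 3) ^+ 2 by rewrite /w; ring.
  by rewrite u3 v3 !expr1n mulr1.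
have [i wE] := prim_rootP (prim3 R (erefl : gcdn 2 6 = 2)) w3.
have -> : ((u * v) ^+ 2)%:M = g ^+ i * h.
  rewrite gE hE (specX eP) (specM eP) -(spec_scalar e) -wE; congr spec.
    have -> : w * u = u ^+ 3 * (u * v) ^+ 2 by rewrite /w; ring.
    by rewrite u3 mul1r.
  have -> : (zeta ^+ 4) ^+ i = w ^+ 2 by rewrite wE -!exprM; congr (_ ^+ _); lia.
  have -> : w ^+ 2 * v = u ^+ 3 * u ^+ 3 * v ^+ 3 * (u * v) ^+ 2 by rewrite /w; ring.
  by rewrite u3 v3 !mul1r.
by apply/HM/Hh/HX.
Qed.

Section Generator.
Variables (h : 'M[C]_2) (r : nat).
Hypotheses (Hh : H h) (r0 : (0 < r)%N) (hr : h ^+ r = 1).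
Hypothesis Hdet : forall x, H x -> exists j, \det x = \det h ^+ j.
Hypothesis hd1 : \det h <> 1.

Lemma relnorm_of_root u n : (0 < n)%N -> u ^+ n = 1 -> relnorm u = 1.
Proof.
move=> n0 un; rewrite /relnorm -sqr_normc.
suff -> : `|u| = 1 by rewrite expr1n.
by apply/eqP; rewrite -(pexpr_eq1 n0) // -normrX un normr1.
Qed.

Lemma det_cases : \det h ^+ 2 = -1 \/ exists i : 'I_6, \det h = zeta ^+ i.
Proof.
have dr : \det h ^+ r = 1 by rewrite -det_exp hr; apply: det1.
have [dt _] := At (H_det Hh).
have [->|d6] := unit_trace (relnorm_of_root r0 dr) dt; first by left.
by right; have [i ->] := prim_rootP (zeta_prim R) d6; exists i.
Qed.

Lemma Hdet_of k j : \det h = \det k ^+ j ->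
  forall x, H x -> exists i, \det x = \det k ^+ i.
Proof. by move=> hk x /Hdet[i ->]; exists (j * i)%N; rewrite hk exprM. Qed.

(** The conjugate of g by h has determinant 1, so it is 1, g or g^2; and it is
    not 1. *)
Lemma conj_cases : h * g = g * h \/ h * g = g ^+ 2 * h.
Proof.
have [HU _ _ HV] := Hgrp; have hU : h \is a GRing.unit := HU _ Hh.
have [||a E] := @SL_gen (h * g * h^-1); first by do ![apply: HM] => //; apply: HV.
  by rewrite det_mul mulrC -det_mul mulKr.
have {}E : h * g = g ^+ a * h by rewrite -E divrK.
rewrite E -(expr_mod a g3); have := ltn_pmod a (ltn0Sn 2).
case: (a %% 3)%N (expr_mod a g3) => [|[|[|//]]] aE _; [|by left|by right].
exfalso; apply: g1; apply: (mulrI hU).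
by rewrite E -aE expr0 mul1r mulr1.
Qed.

(** Each primitive third or sixth root of unity is, up to sign and an integer,
    zeta itself. *)
Lemma A_zeta i : \det h = zeta ^+ i -> i \in [:: 1; 2; 4; 5]%N -> A zeta.
Proof.
move=> dE; have := H_det Hh; rewrite dE => Ai.
have [A1 AB AM] := Ar.
rewrite !inE => /or4P[] /eqP ei; rewrite ei in Ai.
- by [].
- by rewrite -[zeta](subrK 1) -zeta_sqr; apply: subringD.
- by rewrite -[zeta]opprK -zeta4; apply: subringN.
- by rewrite -[zeta](subKr 1) -zeta5; apply: AB.
Qed.

Lemma sqrt3_of_zeta : A zeta -> A sqrt3.
Proof.
move=> Az; have [A1 AB AM] := Ar; rewrite /sqrt3.
by apply: (AB) => //; apply: (AM) => //; apply: subringD.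
Qed.

(** Here h^2 is the scalar -det h, and a power of h is -1, which is not in H,
    unless det h is -1 or a primitive sixth root of unity. In the latter case h or
    h^5 has determinant zeta. *)
Lemma inverting_case : h * g = g ^+ 2 * h -> HC3_2 A H \/ HC3_5 A H.
Proof.
move=> hg; have h2 := inverting_sqr gd gt hg.
have [d2|[i dE]] := det_cases.
  case: H_neg1; have <- : h ^+ 4 = -1; last exact: HX.
  by rewrite (exprM _ 2 2) h2 scalarX sqrrN d2 raddfN.
have h6 : h ^+ 6 = (- (zeta ^+ (3 * i)))%:M.
  by rewrite (exprM _ 2 3) h2 scalarX dE mulnC exprM exprNn -signr_odd expr1 mulN1r.
have h6N : zeta ^+ (3 * i) <> 1.
  by move=> E; case: H_neg1; have <- : h ^+ 6 = -1; [rewrite h6 E raddfN|apply: HX].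
have : i = 1 :> nat \/ i = 3 :> nat \/ i = 5 :> nat.
  have h6N' : ~~ odd i -> (6 %| 3 * i)%N -> False by move=> _ /zeta_exp1.
  case: i {dE h6 h6N} h6N' => -[|[|[|[|[|[|//]]]]]] lt /=;
    first [by move/(_ isT isT)|by auto].
case=> [i1|[i3|i5]].
- right; rewrite i1 expr1 in dE.
  rewrite (H_words Hh Hdet); apply: HC3_5_words => //; last exact: HA.
  by apply: order_zeta => //; apply: (A_zeta (i := 1)).
- left; rewrite i3 zeta3 in dE.
  by rewrite (H_words Hh Hdet); apply: HC3_2_words => //; apply: HA.
- right; rewrite i5 in dE; pose k := h ^+ 5.
  have kd : \det k = zeta.
    by rewrite /k det_exp dE -exprM -[RHS]expr1; apply: zeta_eq.
  have kg : k * g = g ^+ 2 * k.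
    have := words_mul hg 0 5 1 0.
    rewrite -(expr_mod (0 + 2 ^ 5 * 1) g3) (_ : (0 + 2 ^ 5 * 1) %% 3 = 2)%N //.
    by rewrite !mul1r !mulr1.
  have Hk : H k by apply: HX.
  rewrite (H_words Hk (@Hdet_of k 5 _)); last by rewrite kd.
  apply: HC3_5_words => //; last exact: HA.
  by apply: order_zeta => //; apply: (A_zeta dE).
Qed.

(** The element k has k^2 of determinant 1, hence in <g>, so that k^3 is an
    involution. *)
Lemma cube_involution k : H k -> \det k = -1 ->
  [/\ H (k ^+ 3), (k ^+ 3) ^+ 2 = 1 & \det (k ^+ 3) = -1].
Proof.
move=> Hk kd; split; [exact: HX| |by rewrite det_exp kd -signr_odd expr1].
have [||a k2] := @SL_gen (k ^+ 2); first exact: HX.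
  by rewrite det_exp kd sqrrN expr1n.
by rewrite -exprM mulnC exprM k2 -exprM mulnC exprM g3 expr1n.
Qed.

(** The eigenvalues u, v are combinations of tr h and tr (g h) with coefficients
    in Q(sqrt(-3)): precisely u sqrt(-3) and v sqrt(-3) are in A. Since u and v
    are roots of unity, their sixth powers are 1. *)
Lemma eigenvalues_exp6 e u v : idem1 e -> g = spec e (zeta ^+ 2) (zeta ^+ 4) ->
  A zeta -> h = spec e u v -> u ^+ 6 = 1 /\ v ^+ 6 = 1.
Proof.
move=> eP gE Az hE; have [_ AB AM] := Ar; have As := sqrt3_of_zeta Az.
have [ur vr] : u ^+ r = 1 /\ v ^+ r = 1.
  by apply: (spec_inj eP); rewrite -(specX eP) -hE hr spec_scalar.
have tA : A (u + v) by have := H_tr Hh; rewrite hE (spec_tr eP).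
have tgA : A ((zeta - 1) * u - zeta * v).
  have := H_tr (HM gH Hh).
  by rewrite gE hE (specM eP) (spec_tr eP) zeta_sqr zeta4 mulNr.
have norm6 w : w ^+ r = 1 -> A (w * sqrt3) -> w ^+ 6 = 1.
  move=> wr wA; apply: sixth_root; first exact: relnorm_of_root wr.
    by case: (At wA).
  by case: (At (AM _ _ wA As)).
split; apply: norm6 => //.
  have -> : u * sqrt3 = ((zeta - 1) * u - zeta * v) + zeta * (u + v).
    by rewrite /sqrt3; ring.
  by apply: (subringD Ar) => //; apply: AM.
have -> : v * sqrt3 = zeta * zeta * (u + v) - ((zeta - 1) * u - zeta * v).
  by rewrite -expr2 zeta_sqr /sqrt3; ring.
by apply: (AB) => //; apply: (AM) => //; apply: AM.
Qed.

Section Commuting.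
Hypothesis hg : h * g = g * h.

Lemma commX n : h ^+ n * g = g * h ^+ n.
Proof. exact/esym/commrX. Qed.

(** The involution h^6 puts sqrt(-3) in A, whose roots of unity are then of
    order dividing 6. *)
Lemma commuting_det_sqr : \det h ^+ 2 <> -1.
Proof.
move=> d2; have [e [eP gE ec]] := trace_spec gd gt.
have [|Hk k2 kd] := cube_involution (HX 2 Hh); first by rewrite det_exp.
have kg : (h ^+ 2) ^+ 3 * g = g * (h ^+ 2) ^+ 3 by rewrite -exprM commX.
have [As _] := involution_sqrt3 eP gE ec Hk kg k2 kd.
have [_ _ AM] := Ar; have Ad := H_det Hh.
have dr : \det h ^+ r = 1 by rewrite -det_exp hr; apply: det1.
have dA := AM _ _ Ad As.
have : \det h ^+ 6 = 1.
  by apply: sixth_root (relnorm_of_root r0 dr) (At dA).1 (At (AM _ _ dA As)).1.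
rewrite (exprM _ 2 3) d2 -signr_odd expr1 => /eqP.
by rewrite eqNr oner_eq0.
Qed.

(** H is generated by g, of order 3, and by an involution k commuting with it, so
    it is cyclic of order 6, generated by g k and by g^2 k; one of these has
    eigenvalues zeta and zeta^2. *)
Lemma commuting_type1 : \det h = -1 -> HC3_1 A H.
Proof.
move=> dE; have [e [eP gE ec]] := trace_spec gd gt.
have [Hk k2 kd] := cube_involution Hh dE; have kg := commX 3.
set k := h ^+ 3 in Hk k2 kd kg.
have [As kE] := involution_sqrt3 eP gE ec Hk kg k2 kd.
have Hwords : H = words g k.
  by apply: H_words => //; apply: (@Hdet_of _ 1); rewrite kd dE.
have cyclic c m : idem1 m -> c = spec m zeta (zeta ^+ 2) -> H c ->
    (exists a, g = c ^+ a) -> k = c ^+ 3 -> HC3_1 A H.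
  move=> mP cE Hc [a ga] kc; have c6 : c ^+ 6 = 1.
    by rewrite cE; apply: (spec_zeta_exp6 1).
  have -> : H = gen_grp [set c].
    apply/seteqP; split.
      rewrite Hwords (gen_grp1 _ c6) // => _ [p [q ->]].
      by exists (a * p + 3 * q)%N; rewrite ga kc -!exprM -exprD.
    by apply: smallest_sub => // _ ->.
  by apply: (HC3_1_cyclic _ _ mP cE); [apply: order_sqrt3|apply: HA].
have [kE1|kE1] := kE.
  apply: (cyclic (g * k) (1 - e)); first exact: idem1C.
  - rewrite gE kE1 (specM eP) specC; congr spec; last by rewrite mulr1.
    by rewrite zeta4 mulrN1 opprK.
  - exact: HM.
  - exists 4; rewrite gE kE1 (specM eP) (specX eP) mulr1 zeta4 mulrN1 opprK.
    by rewrite zeta4 -exprM; congr spec; apply: zeta_eq.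
  - rewrite gE kE1 (specM eP) (specX eP) mulr1 zeta4 mulrN1 opprK zeta3.
    by rewrite zetaX_exp1.
have cE : g ^+ 2 * k = spec e zeta (zeta ^+ 2).
  rewrite gE kE1 (specX eP) (specM eP) -!exprM mulr1 [zeta ^+ (2 * 2)]zeta4.
  by rewrite mulrN1 opprK; congr spec; apply: zeta_eq.
apply: (cyclic (g ^+ 2 * k) e) => //.
- by apply: HM => //; apply: HX.
- by exists 2; rewrite cE (specX eP) -exprM; apply: gE.
- by rewrite cE kE1 (specX eP) zeta3 zetaX_exp1.
Qed.

(** The product of the cubes of the eigenvalues is 1, and they are not both -1
    because -1 is not in H; so the eigenvalues are cube roots of unity. *)
Lemma commuting_type3 i : \det h = zeta ^+ i -> i \in [:: 2; 4]%N -> HC3_3 A H.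
Proof.
move=> dE i24; have [e [eP gE ec]] := trace_spec gd gt.
have Az : A zeta.
  by apply: A_zeta dE _; move: i24; rewrite !inE => /orP[] /eqP ->.
have AE := order_zeta Ar At Az.
have [u [v hE]] := ec _ hg; have [u6 v6] := eigenvalues_exp6 eP gE Az hE.
have duv : u * v = zeta ^+ i by rewrite -dE hE (spec_det eP).
have uv3 : u ^+ 3 * v ^+ 3 = 1.
  rewrite -exprMn duv zetaX_exp1 //.
  by move: i24; rewrite !inE => /orP[] /eqP ->.
have u3 : u ^+ 3 = 1.
  have : (u ^+ 3) ^+ 2 == 1 by rewrite -exprM u6.
  rewrite sqrf_eq1 => /orP[] /eqP // u3.
  have v3 : v ^+ 3 = -1 by apply: oppr_inj; rewrite opprK -uv3 u3 mulN1r.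
  case: H_neg1; have <- : h ^+ 3 = -1; last exact: HX.
  by rewrite hE (specX eP) u3 v3 spec_scalar raddfN.
have v3 : v ^+ 3 = 1 by rewrite -uv3 u3 mul1r.
have Hw : H (zeta ^+ 2)%:M.
  have := HX i (scalar_in_H eP gE Hh hE u3 v3).
  rewrite scalarX duv -!exprM; congr (H _%:M); apply: zeta_eq.
  by move: i24; rewrite !inE => /orP[] /eqP ->.
exists g; rewrite (H_words Hw (@Hdet_of _ i _)); first exact: HC3_3_words.
rewrite dE det_scalar2 -!exprM; apply: zeta_eq.
by move: i24; rewrite !inE => /orP[] /eqP ->.
Qed.

(** The preceding argument applied to h^2 gives the scalar zeta^4 in H, while h^3
    is an involution with eigenvalues 1 and -1; their product generates H
    together with g. *)
Lemma commuting_type4 i : \det h = zeta ^+ i -> i \in [:: 1; 5]%N -> HC3_4 A H.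
Proof.
move=> dE i15; have [e [eP gE ec]] := trace_spec gd gt.
have Az : A zeta.
  by apply: A_zeta dE _; move: i15; rewrite !inE => /orP[] /eqP ->.
have AE := order_zeta Ar At Az.
have [u [v hE]] := ec _ hg; have [u6 v6] := eigenvalues_exp6 eP gE Az hE.
have duv : u * v = zeta ^+ i by rewrite -dE hE (spec_det eP).
have Hw : H (zeta ^+ 4)%:M.
  have h2E : h ^+ 2 = spec e (u ^+ 2) (v ^+ 2) by rewrite hE (specX eP).
  have := HX i (scalar_in_H eP gE (HX 2 Hh) h2E _ _).
  rewrite -!exprM u6 v6 => /(_ erefl erefl).
  rewrite scalarX -exprMn duv -!exprM; congr (H _%:M); apply: zeta_eq.
  by move: i15; rewrite !inE => /orP[] /eqP ->.
have k2 : (h ^+ 3) ^+ 2 = 1.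
  by rewrite -exprM hE (specX eP) u6 v6 spec_scalar.
have kd : \det (h ^+ 3) = -1.
  rewrite det_exp dE -exprM -zeta3; apply: zeta_eq.
  by move: i15; rewrite !inE => /orP[] /eqP ->.
have [_ kE] := involution_sqrt3 eP gE ec (HX 3 Hh) (commX 3) k2 kd.
pose c := (zeta ^+ 4)%:M * h ^+ 3.
have Hc : H c by apply: HM => //; apply: HX.
have cg : c * g = g * c by rewrite /c -mulrA commX mulrA scalar_comm mulrA.
have type4 m : idem1 m -> c = spec m zeta (zeta ^+ 4) -> HC3_4 A H.
  move=> mP cE; rewrite (H_words Hc (@Hdet_of _ (5 * i) _)).
    by apply: HC3_4_words cE => //; apply: HA.
  have -> : \det c = zeta ^+ 5 by rewrite cE (spec_det mP) -exprS.
  rewrite dE -exprM; apply: zeta_eq.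
  by move: i15; rewrite !inE => /orP[] /eqP ->.
case: kE => kE.
  apply: (type4 (1 - e)); first exact: idem1C.
  rewrite /c kE -(spec_scalar e) (specM eP) specC mulr1; congr spec.
  by rewrite zeta4 mulrN1 opprK.
apply: (type4 e) => //.
rewrite /c kE -(spec_scalar e) (specM eP) mulr1; congr spec.
by rewrite zeta4 mulrN1 opprK.
Qed.

Lemma commuting_case : [\/ HC3_1 A H, HC3_3 A H | HC3_4 A H].
Proof.
have [/commuting_det_sqr//|[i dE]] := det_cases.
have [i0|[i3|[i24|i15]]] : i = 0 :> nat \/ i = 3 :> nat \/
    (i : nat) \in [:: 2; 4]%N \/ (i : nat) \in [:: 1; 5]%N.
- case: i {dE} => -[|[|[|[|[|[|//]]]]]] lt /=; by auto.
- by case: hd1; rewrite dE i0.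
- by constructor 1; apply: commuting_type1; rewrite dE i3 zeta3.
- by constructor 2; apply: commuting_type3 dE i24.
- by constructor 3; apply: commuting_type4 dE i15.
Qed.

End Commuting.

Lemma classification :
  [\/ HC3_1 A H, HC3_2 A H, HC3_3 A H | HC3_4 A H \/ HC3_5 A H].
Proof.
have [/commuting_case[]|/inverting_case[]] := conj_cases => K.
- by constructor 1.
- by constructor 3.
- by constructor 4; left.
- by constructor 2.
- by constructor 4; right.
Qed.

End Generator.
End Classification.

(** * Examples *)

Section Examples.
Variable R : realType.
Local Notation C := R[i].
Local Notation zeta := (zeta R).
Implicit Types (A : set C) (g h : 'M[C]_2).

Definition mx2 (a b c d : C) : 'M[C]_2 :=
  \matrix_(i < 2, j < 2)
    (if i == 0 then if j == 0 then a else b else if j == 0 then c else d).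

Lemma mx2_GL2 A a b c d v : subring A -> A a -> A b -> A c -> A d -> A v ->
  (a * d - b * c) * v = 1 -> GL2 A (mx2 a b c d).
Proof.
move=> [_ AB AM] Aa Ab Ac Ad Av dv; split.
  by move=> i j; rewrite mxE; case: (i == 0); case: (j == 0).
rewrite det2E !mxE /=; split; last by exists v.
by apply: (AB); apply: (AM).
Qed.

(** The companion matrix of X^2 + X + 1. *)
Definition rot3 : 'M[C]_2 := mx2 0 (-1) 1 (-1).

Lemma rot3_det : \det rot3 = 1.
Proof. by rewrite det2E !mxE /=; ring. Qed.

Lemma rot3_tr : \tr rot3 = -1.
Proof. by rewrite tr2E !mxE /=; ring. Qed.

Lemma rot3_SL2 A : subring A -> SL2 A rot3.
Proof.
move=> Ar; split; last exact: rot3_det; have [A1 _ _] := Ar.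
have A0 := subring0 Ar; have AN := subringN Ar A1.
by apply: (mx2_GL2 (v := 1)) => //; ring.
Qed.

Lemma swap_rot3 u : mx2 0 u u 0 * rot3 = rot3 ^+ 2 * mx2 0 u u 0.
Proof. by rewrite expr2; apply: mx2P; rewrite !(mul2E, mxE) /=; ring. Qed.

Lemma swap_det u : \det (mx2 0 u u 0) = - u ^+ 2.
Proof. by rewrite det2E !mxE /=; ring. Qed.

Definition proj1 : 'M[C]_2 := mx2 1 0 0 0.

Lemma proj1_idem : idem1 proj1.
Proof.
by split; [apply: mx2P; rewrite mul2E !mxE /=; ring|rewrite tr2E !mxE /= addr0].
Qed.

Lemma spec_proj1_GL2 A i k : subring A -> A zeta ->
  GL2 A (spec proj1 (zeta ^+ i) (zeta ^+ k)).
Proof.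
move=> Ar Az.
have -> : spec proj1 (zeta ^+ i) (zeta ^+ k) = mx2 (zeta ^+ i) 0 0 (zeta ^+ k).
  by apply: mx2P; rewrite !mxE /=; ring.
have A0 := subring0 Ar.
apply: (mx2_GL2 (v := zeta ^+ (5 * (i + k)))) => //; try exact: subringX.
by rewrite mulr0 subr0 -!exprD zeta_exp1 // -mulSn dvdn_mulr.
Qed.

Lemma words_subgroup (G : set 'M[C]_2) g h m n k : (0 < m)%N -> (0 < n)%N ->
  g ^+ m = 1 -> h ^+ n = 1 -> h * g = g ^+ k * h ->
  is_group G -> G g -> G h -> is_subgroup (words g h) G.
Proof.
move=> m0 n0 gm hn hg Ggrp Gg Gh; split; first exact: (words_group m0 n0 gm hn hg).
have [_ _ GM _] := Ggrp; move=> _ [a [b ->]].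
by apply: GM; [apply: (group_exp _ Ggrp Gg)|apply: (group_exp _ Ggrp Gh)].
Qed.

Lemma HC3_1_example : exists K, HC3_1 (@ring_of_integers R 3) K.
Proof.
have Er := eisenstein_ring R; have Ez := zeta_eisenstein R.
eexists; rewrite ring_of_integers3; apply: (HC3_1_cyclic _ _ proj1_idem (erefl _)).
  by exists 1%N; rewrite quad_order31.
exact: (spec_proj1_GL2 1).
Qed.

Lemma HC3_4_example : exists K, HC3_4 (@ring_of_integers R 3) K.
Proof.
have Er := eisenstein_ring R; have Ez := zeta_eisenstein R.
have p1 := proj1_idem.
pose g := spec proj1 (zeta ^+ 2) (zeta ^+ 4).
have gd : \det g = 1 by rewrite spec_det // -exprD zeta_exp1.
have gt : \tr g = -1 by rewrite spec_tr // zeta_sqr zeta4; ring.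
have [g3 g1] := trace_order3 gd gt.
eexists; apply: (HC3_4_words _ _ g3 g1 _ _ p1 (erefl _)) => //.
- by rewrite ring_of_integers3; split=> //; apply: spec_proj1_GL2.
- by rewrite ring_of_integers3; apply: (spec_proj1_GL2 1).
- by rewrite !specM //; congr spec; rewrite mulrC.
Qed.

Lemma S3_example n : exists (K : set 'M[C]_2) (g h : 'M[C]_2),
  [/\ is_subgroup K (GL2 (@Qsqrt R n)), presented 2 g h K &
      isom_fin K [group of [set: 'S_3]]].
Proof.
have Qr := @Qsqrt_ring R n; have [Q1 _ _] := Qr; have Q0 := subring0 Qr.
have [g3 g1] := trace_order3 rot3_det rot3_tr.
pose h := mx2 0 1 1 0; have hg : h * rot3 = rot3 ^+ 2 * h := swap_rot3 1.
have hd : \det h = -1 by rewrite swap_det expr1n.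
have h2 : h ^+ 2 = 1 by rewrite (inverting_sqr rot3_det rot3_tr hg) hd opprK.
have [pr iso] := S3_words rot3_det g3 g1 h2 hd hg.
exists (words rot3 h), rot3, h; split=> //.
apply: (words_subgroup _ _ g3 h2 hg) => //; first exact: GL2_group.
  by have [] := rot3_SL2 Qr.
apply: (mx2_GL2 (v := -1)) => //; last by ring.
exact: subringN.
Qed.

(** The determinant -u^2 of the antidiagonal matrix of u = zeta^2 is zeta. *)
Lemma order18_example : exists (K : set 'M[C]_2) (g h : 'M[C]_2),
  [/\ is_subgroup K (GL2 (@Qsqrt R 3)), presented 6 g h K & K #= `I_18].
Proof.
have Qr := @Qsqrt_ring R 3; have Q0 := subring0 Qr.
have Qz : Qsqrt 3 zeta by apply: eisenstein_Qsqrt3; apply: zeta_eisenstein.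
have [g3 g1] := trace_order3 rot3_det rot3_tr.
pose h := mx2 0 (zeta ^+ 2) (zeta ^+ 2) 0.
have hg : h * rot3 = rot3 ^+ 2 * h := swap_rot3 (zeta ^+ 2).
have hd : \det h = zeta by rewrite swap_det -exprM zeta4 opprK.
have [h6 pr card] := order18_words rot3_det g3 g1 hd hg.
exists (words rot3 h), rot3, h; split=> //.
apply: (words_subgroup _ _ g3 h6 hg) => //; first exact: GL2_group.
  by have [] := rot3_SL2 Qr.
have Qz2 := subringX Qr 2 Qz.
apply: (mx2_GL2 (v := zeta ^+ 5)) => //; first exact: subringX.
by rewrite mulr0 sub0r -exprD zeta4 opprK -exprS zeta_exp1.
Qed.

End Examples.

(** * The theorem *)

Theorem corollary35 (R : realType) :
  (* the classification *)
  (forall (A : set R[i]) (H : set 'M[R[i]]_2) (g h_o : 'M[R[i]]_2)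
     (r s : nat) (l1 l2 : R[i]),
     is_End_elliptic A ->
     is_subgroup H (GL2 A) ->
     finite_set H ->
     H `&` SL2 A = gen_grp [set g] ->
     isom_fin (H `&` SL2 A) (Cyc 3) ->
     H h_o ->
     has_order h_o r ->
     [set \det x | x in H] = gen_grp [set \det h_o] ->
     isom_fin [set \det x | x in H] (Cyc s) ->
     (1 < s)%N ->
     eigenvalues h_o l1 l2 ->
     exists K : set 'M[R[i]]_2,
       isom_grp H K /\
       [\/ HC3_1 A K, HC3_2 A K, HC3_3 A K | HC3_4 A K \/ HC3_5 A K])
  (* the third case is available for any g of trace -1 *)
  /\ (forall g : 'M[R[i]]_2,
        SL2 (ring_of_integers 3) g -> \tr g = -1 ->
        exists K, HC3_3_of (ring_of_integers 3) g K)
  (* existence in GL(2, O_{-3}) *)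
  /\ (exists K : set 'M[R[i]]_2, HC3_1 (ring_of_integers 3) K)
  /\ (exists K : set 'M[R[i]]_2, HC3_3 (ring_of_integers 3) K)
  /\ (exists K : set 'M[R[i]]_2, HC3_4 (ring_of_integers 3) K)
  (* existence over the fields Q(sqrt(-d)) and Q(sqrt(-3)) *)
  /\ (forall d : nat, (0 < d)%N ->
        exists (K : set 'M[R[i]]_2) (g h : 'M[R[i]]_2),
          [/\ is_subgroup K (GL2 (Qsqrt d)), presented 2 g h K &
              isom_fin K [group of [set: 'S_3]]])
  /\ (exists (K : set 'M[R[i]]_2) (g h : 'M[R[i]]_2),
        [/\ is_subgroup K (GL2 (Qsqrt 3)), presented 6 g h K &
            K #= `I_18]).
Proof.
have Er := eisenstein_ring R.
have E3 := ring_of_integers3 R.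
have type3 (g : 'M[R[i]]_2) : SL2 (ring_of_integers 3) g -> \tr g = -1 ->
    exists K, HC3_3_of (ring_of_integers 3) g K.
  by move=> gS gt; eexists; apply: HC3_3_words.
split; last split; last split; last split; last split; last split.
- move=> A H g h r s l1 l2 EA [Hgrp HA] _ HSL isoC Hh [r0 hr _] HD isoD s1 _.
  have Ar := End_ring EA; have At := End_traces EA.
  have HU : H `&` SL2 A `<=` [set x | x \is a GRing.unit].
    by case: Hgrp => HU _ _ _ x [/HU].
  have Hg : (H `&` SL2 A) g by rewrite HSL; apply: sub_gen_smallest.
  have g3 : g ^+ 3 = 1 by apply: (isom_Cyc_expn _ HU isoC Hg).
  have g1 : g <> 1 by move: isoC; rewrite HSL => /isom_Cyc_generator_neq1; apply.
  have d1 : \det h <> 1 by move: isoD; rewrite HD => /isom_Cyc_generator_neq1; apply.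
  have dr : \det h ^+ r = 1 by rewrite -det_exp hr; apply: det1.
  have Hdet x : H x -> exists j, \det x = \det h ^+ j.
    move=> Hx; have : [set \det x | x in H] (\det x) by exists x.
    by rewrite HD (gen_grp1 r0 dr).
  exists H; split; first by exists id; split=> //; split=> // x Hx; exists x.
  exact: (classification Ar At Hgrp HA HSL g3 g1 Hh r0 hr Hdet d1).
- exact: type3.
- exact: HC3_1_example.
- have [|K HK] := type3 (rot3 R) _ (rot3_tr R); first by rewrite E3; apply: rot3_SL2.
  by exists K, (rot3 R).
- exact: HC3_4_example.
- by move=> d _; apply: S3_example.
- exact: order18_example.
Qed.
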